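(* There exists a unique linear map $\mathcal{B}^*:\mathbb{C}[M_{n,n}]\to \mathbf{U}(gl(n))$ such that $\mathcal{B}^*\big((S|T)^*\big)=[S|T]^*$ for every pair $S,T$ of Young tableaux on $\{1,\dots,n\}$ of the same shape.
   Context: $\mathbb{C}[M_{n,n}]$ is the polynomial algebra in the commuting indeterminates $(i|j)$, $1\le i,j\le n$ (identified with $\mathbf{Sym}(gl(n))$ via $e_{ij}\mapsto (i|j)$). A Young tableau $S$ of shape $\lambda=(\lambda_1\ge\dots\ge\lambda_m>0)$ on an alphabet is a sequence of words $(\omega_1,\dots,\omega_m)$ with $\ell(\omega_r)=\lambda_r$ (repetitions allowed). For words $\omega=i_1\cdots i_p$, $\varpi=j_1\cdots j_p$, the *-biproduct is the permanent $(\omega|\varpi)^*=\mathrm{per}\big((i_r|j_s)\big)_{r,s=1}^p$, and for $S=(\omega_1,\dots,\omega_m)$, $T=(\varpi_1,\dots,\varpi_m)$ of the same shape, $(S|T)^*=(\omega_1|\varpi_1)^*\cdots(\omega_m|\varpi_m)^*$. Capelli *-bitableaux (virtual variables). Let $A_0=\{\alpha_1,\dots,\alpha_{m_0}\}$ (positive virtual symbols, parity $0$), $A_1=\{\beta_1,\dots,\beta_{m_1}\}$ (negative virtual symbols, parity $1$), $L=\{1,\dots,n\}$ (proper symbols, parity $1$), with $m_0,m_1$ sufficiently large. Let $gl(m_0|m_1+n)$ be the Lie superalgebra with homogeneous basis $e_{a,b}$ ($a,b\in A_0\cup A_1\cup L$) of parity $|a|+|b|\bmod 2$ and superbracket $[e_{a,b},e_{c,d}]=\delta_{bc}e_{a,d}-(-1)^{(|a|+|b|)(|c|+|d|)}\delta_{ad}e_{c,b}$;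 the $e_{i,j}$, $i,j\in L$, span a copy of $gl(n)$, so $\mathbf{U}(gl(n))\subset\mathbf{U}(gl(m_0|m_1+n))$. A product $e_{a_m,b_m}\cdots e_{a_1,b_1}$ is irregular if there are $i\le m$ and $\gamma\in A_0\cup A_1$ with $\#\{j\le i: b_j=\gamma\}>\#\{j<i:a_j=\gamma\}$. Let $\mathbf{Irr}$ be the left ideal generated by irregular products. It is known that $\mathbf{U}(gl(n))+\mathbf{Irr}$ is a direct sum and a subalgebra $Virt$ in which $\mathbf{Irr}$ is a two-sided ideal; $\mathfrak p:Virt\to\mathbf{U}(gl(n))$ is the projection with kernel $\mathbf{Irr}$. For tableaux $S,T$ of the same shape, $e_{S,T}$ is the product, over rows from first to last and within each row from left to right, of $e_{s,t}$ with $s,t$ corresponding entries. For a shape $\lambda$ with $m$ rows, $D'_\lambda$ is the tableau of shape $\lambda$ whose $r$-th row is $\beta_r$ repeated $\lambda_r$ times. The Capelli *-bitableau is $[S|T]^*=\mathfrak p(e_{S,D'_\lambda}e_{D'_\lambda,T})\in\mathbf{U}(gl(n))$. *)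

(* Defs.v *)
From HB Require Import structures.
From mathcomp Require Import all_boot all_order all_algebra all_fingroup.
Set Implicit Arguments. Unset Strict Implicit. Unset Printing Implicit Defensive.
Import Order.TTheory GRing.Theory Num.Theory.
Local Open Scope ring_scope.

(* Free associative algebra R<X>, represented by coefficient functions *)
(* on words (seq X); a monomial x_1 ... x_k is the word [:: x_1;..;x_k] *)
(* read left to right.  Multiplication is concatenation (convolution).  *)
Section FreeAlg.
Variables (R : nzRingType) (X : eqType).

Definition ser := seq X -> R.

Definition smul (f g : ser) : ser :=
  fun w => \sum_(i < (size w).+1) f (take i w) * g (drop i w).

Definition sword (u : seq X) : ser := fun w => (w == u)%:R.

Definition ssum (T : Type) (l : seq T) (F : T -> ser) : ser :=
  fun w => \sum_(t <- l) F t w.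

End FreeAlg.
Arguments sword R {X} u _.
Arguments ser : clear implicits.

(* Universal enveloping (super)algebra of gl over a Z_2-graded set of  *)
(* symbols Sym with parity par: the quotient of the free algebra on    *)
(* generators e_{a,b} = (a,b) by the two-sided ideal J generated by    *)
(*   e_x e_y - (-1)^{|x||y|} e_y e_x - [e_x, e_y],                     *)
(*   [e_{a,b},e_{c,d}] = d_{bc} e_{a,d} - (-1)^{(|a|+|b|)(|c|+|d|)}    *)
(*                        d_{ad} e_{c,b}.                              *)
(* Elements of U are handled through representatives in the free       *)
(* algebra; equality in U is congruence modulo J (inJ).                *)
Section Envelope.
Variables (R : nzRingType) (Sym : eqType) (par : Sym -> bool).

Definition gpar (x : (Sym * Sym)%type) : bool := par x.1 (+) par x.2.

Definition relJ (x y : (Sym * Sym)%type) : ser R (Sym * Sym)%type :=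
  let s : R := if gpar x && gpar y then -1 else 1 in
  fun w =>
    smul (sword R [:: x]) (sword R [:: y]) w
    - s * smul (sword R [:: y]) (sword R [:: x]) w
    - ((x.2 == y.1)%:R * sword R [:: (x.1, y.2)] w
       - s * (x.1 == y.2)%:R * sword R [:: (y.1, x.2)] w).

Definition inJ (f : ser R (Sym * Sym)%type) : Prop :=
  exists l : seq (R * seq (Sym * Sym)%type * (Sym * Sym)%type * (Sym * Sym)%type * seq (Sym * Sym)%type),
    forall w, f w =
      ssum l (fun t => fun w' => t.1.1.1.1 *
        smul (smul (sword R t.1.1.1.2) (relJ t.1.1.2 t.1.2)) (sword R t.2) w') w.

End Envelope.

(* U(gl(n)): symbols L = 'I_n, all of parity 1 (proper symbols).       *)
Definition parL (n : nat) : 'I_n -> bool := fun _ => true.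

(* U(gl(m0|m1+n)): symbols A0 + (A1 + L); A0 = 'I_m0 (alpha's, parity *)
(* 0), A1 = 'I_m1 (beta's, parity 1), L = 'I_n (parity 1).             *)
Definition ssym (m0 m1 n : nat) : finType := ('I_m0 + ('I_m1 + 'I_n))%type.

Definition parS (m0 m1 n : nat) (a : ssym m0 m1 n) : bool :=
  match a with inl _ => false | inr _ => true end.

Definition virtual (m0 m1 n : nat) (a : ssym m0 m1 n) : bool :=
  match a with inl _ => true | inr (inl _) => true | inr (inr _) => false end.

Definition psym (m0 m1 n : nat) (i : 'I_n) : ssym m0 m1 n := inr (inr i).

(* beta_{r+1} (rows numbered from 0); None if r >= m1 *)
Definition bsym (m0 m1 n : nat) (r : nat) : option (ssym m0 m1 n) :=
  omap (fun i : 'I_m1 => inr (inl i)) (insub r).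

(* The word [:: (a_m,b_m); ...; (a_1,b_1)] stands for e_{a_m,b_m}...e_{a_1,b_1}.
   It is irregular iff there are i <= m and a virtual gamma with
   #{j <= i : b_j = gamma} > #{j < i : a_j = gamma}. *)
Definition irregular (m0 m1 n : nat) (w : seq (ssym m0 m1 n * ssym m0 m1 n)%type) : bool :=
  let r := rev w in
  [exists k : 'I_(size w), exists g : ssym m0 m1 n,
     virtual g &&
     (count (fun x => x.1 == g) (take k r) < count (fun x => x.2 == g) (take k.+1 r))%N].

(* f lies in Irr (+ J): the left ideal of U(gl(m0|m1+n)) generated by
   the irregular products *)
Definition inIrr (R : nzRingType) (m0 m1 n : nat)
    (f : ser R (ssym m0 m1 n * ssym m0 m1 n)%type) : Prop :=
  exists l : seq (R * seq (ssym m0 m1 n * ssym m0 m1 n)%type * seq (ssym m0 m1 n * ssym m0 m1 n)%type),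
    all (fun t => irregular t.2) l /\
    inJ (@parS m0 m1 n)
      (fun w => f w - ssum l (fun t => fun w' => t.1.1 * sword R (t.1.2 ++ t.2) w') w).

(* the inclusion U(gl(n)) -> U(gl(m0|m1+n)), e_{ij} |-> e_{ij} *)
Definition unemb (m0 m1 n : nat) (x : ssym m0 m1 n * ssym m0 m1 n) : option ('I_n * 'I_n)%type :=
  match x with
  | (inr (inr i), inr (inr j)) => Some (i, j)
  | _ => None
  end.

Definition embedF (R : nzRingType) (m0 m1 n : nat) (f : ser R ('I_n * 'I_n)%type)
  : ser R (ssym m0 m1 n * ssym m0 m1 n)%type :=
  fun w => if all (fun x => unemb x != None) w then f (pmap (@unemb m0 m1 n) w) else 0.

(* Young tableaux on L = 'I_n : a list of rows (words).                *)
Definition shape (n : nat) (S : seq (seq 'I_n)) : seq nat := map size S.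

Definition is_partition (l : seq nat) : bool :=
  sorted (fun a b => b <= a)%N l && all (fun k => 0 < k)%N l.

Definition young_pair (n : nat) (S T : seq (seq 'I_n)) : bool :=
  is_partition (shape S) && (shape S == shape T).

Definition wSD (m0 m1 n : nat) (S : seq (seq 'I_n)) : seq (ssym m0 m1 n * ssym m0 m1 n)%type :=
  flatten (map (fun rw : (nat * seq 'I_n)%type =>
     if @bsym m0 m1 n rw.1 is Some b then [seq (@psym m0 m1 n s, b) | s <- rw.2] else [::])
   (zip (iota 0 (size S)) S)).

Definition wDT (m0 m1 n : nat) (T : seq (seq 'I_n)) : seq (ssym m0 m1 n * ssym m0 m1 n)%type :=
  flatten (map (fun rw : (nat * seq 'I_n)%type =>
     if @bsym m0 m1 n rw.1 is Some b then [seq (b, @psym m0 m1 n t) | t <- rw.2] else [::])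
   (zip (iota 0 (size T)) T)).

(* C[M_{n,n}]: commutative polynomials in the (i|j).  A polynomial is  *)
(* a finitely supported coefficient function on monomials (exponent    *)
(* vectors); polynomial expressions are built as formal lists of terms *)
(* and read off through pcoef.                                          *)
Definition mon (n : nat) := {ffun ('I_n * 'I_n)%type -> nat}.

Definition finsupp (R : nzRingType) (n : nat) (p : mon n -> R) : Prop :=
  exists s : seq (mon n), forall m, p m != 0 -> m \in s.

Definition pcoef (R : nzRingType) (n : nat) (p : seq (R * mon n)%type) : mon n -> R :=
  fun m => \sum_(t <- p | t.2 == m) t.1.

Definition plmul (R : nzRingType) (n : nat) (p q : seq (R * mon n)%type) : seq (R * mon n)%type :=
  [seq (a.1 * b.1, [ffun k => (a.2 k + b.2 k)%N] : mon n)
   | a : (R * mon n)%type <- p, b : (R * mon n)%type <- q].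

Definition punit (R : nzRingType) (n : nat) : seq (R * mon n)%type :=
  [:: (1, [ffun _ => 0%N])].

(* the monomial prod_r (omega_r | varpi_{sigma r});  the default value of
   nth is never used when size omega = size varpi *)
Definition pmon (n : nat) (om vp : seq 'I_n) (s : 'S_(size om)) : mon n :=
  [ffun k : ('I_n * 'I_n)%type =>
     #|[pred r : 'I_(size om) | (tnth (in_tuple om) r == k.1) && (nth k.2 vp (s r) == k.2)]|].

Definition per (R : nzRingType) (n : nat) (om vp : seq 'I_n) : seq (R * mon n)%type :=
  [seq (1, @pmon n om vp s) | s : 'S_(size om)].

Definition bitab (R : nzRingType) (n : nat) (S T : seq (seq 'I_n)) : mon n -> R :=
  pcoef (foldr (@plmul R n) (punit R n) (map (fun x => per R x.1 x.2) (zip S T))).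

Definition linmap (R : nzRingType) (n : nat) (B : (mon n -> R) -> ser R ('I_n * 'I_n)%type) : Prop :=
  forall (a : R) (p q : mon n -> R), finsupp p -> finsupp q ->
    inJ (@parL n) (fun w => B (fun m => a * p m + q m) w - (a * B p w + B q w)).

(* u = [S|T]^* :  for all sufficiently large m0, m1 the element u of
   U(gl(n)) is congruent to e_{S,D'} e_{D',T} modulo Irr, i.e.
   u = p(e_{S,D'} e_{D',T}) (U(gl(n)) + Irr being direct). *)
Definition capelli (R : nzRingType) (n : nat) (S T : seq (seq 'I_n))
    (u : ser R ('I_n * 'I_n)%type) : Prop :=
  exists M : nat, forall m0 m1 : nat, (M <= m0)%N -> (M <= m1)%N -> (size S <= m1)%N ->
    @inIrr R m0 m1 n (fun w => @embedF R m0 m1 n u w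
                          - sword R (@wSD m0 m1 n S ++ @wDT m0 m1 n T) w).

(* Main.v *)
Require Import Defs.
From HB Require Import structures.
From mathcomp Require Import all_boot all_order all_algebra all_fingroup.
From mathcomp Require Import boolp functions.
From mathcomp Require Import ring zify.
Set Implicit Arguments. Unset Strict Implicit. Unset Printing Implicit Defensive.
Import Order.TTheory GRing.Theory Num.Theory.
Local Open Scope ring_scope.

(** A monomial (i_1|j_1)...(i_h|j_h) is sent to the normally ordered product
    :e_{i_1 j_1} ... e_{i_h j_h}:, given by the recursion
      :e_{ij} s: = e_{ij} :s: - (sum of the :s':, s' being s with one pair (j,l)
                                 replaced by (i,l)).
    Modulo Irr, pushing the letters e_{i,beta} of e_{S,D'} to the right through
    e_{D',T}, where they become irregular, leaves one normally ordered product for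
    each row-preserving bijection between the entries of S and those of T, which
    is the expansion of the permanents in (S|T)*.  With pairwise distinct
    beta's there is a single bijection, so the normally ordered product does not
    depend on the order of its factors.

    For uniqueness, every monomial is a bitableau of column shape, and it remains
    to see that U(gl(n)) meets Irr trivially.  Matrix coefficients of tensor
    powers of two copies V + V' of the defining representation, where gl acts on
    V' through V, vanish on Irr as soon as the vector involves proper symbols
    only.  Those from V'^{(x)h} to V^{(x)h} vanish on words of length < h and count
    the permutations matching a word of length h with a given one; with the
    spanning half of the Poincare-Birkhoff-Witt theorem this separates U(gl(n)). *)

(** * Formal linear combinations of words *)

Section FormalSums.
Variables (R : comNzRingType) (X : eqType).
Implicit Types (u v w : seq X) (l : seq (R * seq X)).

Definition ev l : ser R X := fun w => \sum_(t <- l) t.1 * sword R t.2 w.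

Definition pair_sum (psi : seq X -> R) l : R := \sum_(t <- l) t.1 * psi t.2.

Definition ctx u v l : seq (R * seq X) := [seq (t.1, u ++ t.2 ++ v) | t <- l].

Definition scl (c : R) l : seq (R * seq X) := [seq (c * t.1, t.2) | t <- l].

Lemma ev_nil : ev [::] = (0 : seq X -> R).
Proof. by apply/funext => w; rewrite /ev big_nil. Qed.

Lemma ev_cat l l' : ev (l ++ l') = (ev l : seq X -> R) + (ev l' : seq X -> R).
Proof. by apply/funext => w; rewrite /ev big_cat. Qed.

Lemma ev_scl c l w : ev (scl c l) w = c * ev l w.
Proof. by rewrite /ev big_map mulr_sumr; apply: eq_bigr => t _; rewrite mulrA. Qed.

Lemma pair_sum_cat psi l l' : pair_sum psi (l ++ l') = pair_sum psi l + pair_sum psi l'.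
Proof. by rewrite /pair_sum big_cat. Qed.

Lemma pair_sum_scl psi c l : pair_sum psi (scl c l) = c * pair_sum psi l.
Proof.
by rewrite /pair_sum big_map mulr_sumr; apply: eq_bigr => t _; rewrite mulrA.
Qed.

Lemma pair_sum_ev psi (s : seq (seq X)) l : uniq s ->
  {subset map snd l <= s} -> pair_sum psi l = \sum_(w <- s) ev l w * psi w.
Proof.
move=> us sub; under eq_bigr do rewrite /ev mulr_suml.
rewrite exchange_big /=; apply: eq_big_seq => t tl.
have ts : t.2 \in s by apply/sub/map_f.
rewrite (bigD1_seq t.2) //= /sword eqxx mulr1 big1 ?addr0 // => w /negPf nw.
by rewrite nw mulr0 mul0r.
Qed.

(** A formal sum may repeat words. On a common duplicate-free list both pairings are read off the
    coefficients, so [pair_sum psi] is a functional on elements of the free algebra. *)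
Lemma pair_sum_ev_eq psi l l' : ev l = ev l' -> pair_sum psi l = pair_sum psi l'.
Proof.
move=> e; pose s := undup (map snd (l ++ l')).
rewrite !(@pair_sum_ev psi s) ?undup_uniq // ?e // => w wl.
- by rewrite mem_undup map_cat mem_cat wl orbT.
- by rewrite mem_undup map_cat mem_cat wl.
Qed.

Lemma smul_sword u v : smul (sword R u) (sword R v) = sword R (u ++ v).
Proof.
apply/funext => w; rewrite /smul /sword; have [->|nw] := eqVneq w (u ++ v).
  have lt : (size u < (size (u ++ v)).+1)%N by rewrite size_cat ltnS leq_addr.
  rewrite (bigD1 (Ordinal lt)) //= take_size_cat // drop_size_cat // !eqxx mulr1.
  rewrite big1 ?addr0 // => i /eqP ni; case: eqP => [e|_]; last by rewrite mul0r.
  case: ni; apply/val_inj => /=; rewrite -[in RHS]e size_takel //.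
  by rewrite -ltnS.
rewrite big1 // => i _; case: eqP => [e1|_]; last by rewrite mul0r.
case: eqP => [e2|_]; last by rewrite mulr0.
by move: nw; rewrite -{1}(cat_take_drop i w) e1 e2 eqxx.
Qed.

Lemma smul_sword_ev u l : smul (sword R u) (ev l) = ev (ctx u [::] l).
Proof.
apply/funext => w; rewrite /smul /ev big_map /=.
under eq_bigr do rewrite mulr_sumr.
rewrite exchange_big /=; apply: eq_bigr => t _; rewrite cats0 -smul_sword /smul.
by rewrite mulr_sumr; apply: eq_bigr => i _; ring.
Qed.

Lemma smul_ev_sword l v : smul (ev l) (sword R v) = ev (ctx [::] v l).
Proof.
apply/funext => w; rewrite /smul /ev big_map /=.
under eq_bigr do rewrite mulr_suml.
rewrite exchange_big /=; apply: eq_bigr => t _; rewrite -smul_sword /smul.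
by rewrite mulr_sumr; apply: eq_bigr => i _; ring.
Qed.

Lemma ctx_ctx u v u' v' l : ctx u v (ctx u' v' l) = ctx (u ++ u') (v' ++ v) l.
Proof. by rewrite /ctx -map_comp; apply: eq_map => t /=; rewrite !catA. Qed.

Lemma finite_ev (f : ser R X) (s : seq (seq X)) :
  (forall w, f w != 0 -> w \in s) -> f = ev [seq (f w, w) | w <- undup s].
Proof.
move=> sup; apply/funext => w; rewrite /ev big_map /=.
have [ws|nws] := boolP (w \in undup s).
  rewrite (bigD1_seq w) ?undup_uniq //= /sword eqxx mulr1 big1 ?addr0 //.
  by move=> v; rewrite eq_sym => /negPf ->; rewrite mulr0.
rewrite big_seq big1 => [|v vs].
  by apply/eqP; apply: contraNT nws => /sup; rewrite mem_undup.
by rewrite /sword; case: eqP vs nws => [-> ->|]; rewrite ?mulr0.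
Qed.

Lemma ev_neq0_mem l w : ev l w != 0 -> w \in map snd l.
Proof.
apply: contraNT => nw; rewrite /ev big_seq big1 ?eqxx // => t tl.
rewrite /sword; case: eqP => [e|_]; last by rewrite mulr0.
by case/negP: nw; rewrite e map_f.
Qed.

Lemma ev_coef0 l : (forall v, \sum_(t <- l | t.2 == v) t.1 = 0) ->
  ev l = (0 : seq X -> R).
Proof.
move=> h; apply/funext => w; transitivity (\sum_(t <- l | t.2 == w) t.1); last exact: h.
rewrite /ev [RHS]big_mkcond /=; apply: eq_bigr => t _; rewrite /sword eq_sym.
by case: eqP; rewrite ?mulr1 ?mulr0.
Qed.

End FormalSums.

(** * The ideal of the enveloping superalgebra and the functionals vanishing on it *)

Section Congruence.
Variables (R : comNzRingType) (Sym : eqType) (par : Sym -> bool).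
Local Notation X := (Sym * Sym)%type.
Implicit Types (u v w : seq X) (l : seq (R * seq X)).

Definition sgn (x y : X) : R := if gpar par x && gpar par y then -1 else 1.

Definition rel_terms (x y : X) : seq (R * seq X) :=
  [:: (1, [:: x; y]); (- sgn x y, [:: y; x]);
      (- (x.2 == y.1)%:R, [:: (x.1, y.2)]);
      (sgn x y * (x.1 == y.2)%:R, [:: (y.1, x.2)])].

Lemma relJ_ev x y : relJ R par x y = ev (rel_terms x y).
Proof.
apply/funext => w; rewrite /relJ /ev /rel_terms !big_cons big_nil /=.
by rewrite !smul_sword /= -/(sgn x y); ring.
Qed.

Lemma relJ_ctx u v x y :
  smul (smul (sword R u) (relJ R par x y)) (sword R v) = ev (ctx u v (rel_terms x y)).
Proof. by rewrite relJ_ev smul_sword_ev smul_ev_sword ctx_ctx. Qed.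

Lemma inJ_rel u x y v : inJ par (ev (ctx u v (rel_terms x y))).
Proof.
exists [:: (1, u, x, y, v)] => w.
by rewrite /ssum big_seq1 /= mul1r relJ_ctx.
Qed.

Lemma inJ0 : inJ par (0 : seq X -> R).
Proof. by exists [::] => w; rewrite /ssum big_nil. Qed.

Lemma inJD (f g : seq X -> R) : inJ par f -> inJ par g -> inJ par (f + g).
Proof.
case=> l hl [l' hl']; exists (l ++ l') => w; rewrite /ssum big_cat /=.
by congr (_ + _); [apply: hl | apply: hl'].
Qed.

Lemma inJZ c (f : seq X -> R) : inJ par f -> inJ par (fun w => c * f w).
Proof.
case=> l hl; exists [seq (c * t.1.1.1.1, t.1.1.1.2, t.1.1.2, t.1.2, t.2) | t <- l] => w.
rewrite hl /ssum big_map mulr_sumr; apply: eq_bigr => t _ /=; exact: mulrA.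
Qed.

Lemma inJN (f : seq X -> R) : inJ par f -> inJ par (- f).
Proof. by move/(inJZ (-1)); congr inJ; apply/funext => w; rewrite mulN1r. Qed.

Lemma inJB (f g : seq X -> R) : inJ par f -> inJ par g -> inJ par (f - g).
Proof. by move=> hf hg; apply: inJD => //; apply: inJN. Qed.

Lemma inJ_sum (T : Type) (r : seq T) (F : T -> seq X -> R) :
  (forall t, inJ par (F t)) -> inJ par (fun w => \sum_(t <- r) F t w).
Proof.
move=> h; elim: r => [|t r IH].
  by have := inJ0; congr inJ; apply/funext => w; rewrite big_nil.
by have := inJD (h t) IH; congr inJ; apply/funext => w; rewrite big_cons.
Qed.

Lemma inJ_terms (f : ser R X) : inJ par f -> exists2 l, f = ev l &
  forall psi, (forall u v x y, pair_sum psi (ctx u v (rel_terms x y)) = 0) ->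
    pair_sum psi l = 0.
Proof.
case=> l hl.
exists (flatten [seq scl t.1.1.1.1 (ctx t.1.1.1.2 t.2 (rel_terms t.1.1.2 t.1.2)) | t <- l]).
  apply/funext => w; rewrite hl /ssum /ev big_flatten /= big_map.
  by apply: eq_bigr => t _; rewrite relJ_ctx -ev_scl.
move=> psi h; rewrite /pair_sum big_flatten big_map big1 // => t _.
by have := pair_sum_scl psi t.1.1.1.1 (ctx t.1.1.1.2 t.2 (rel_terms t.1.1.2 t.1.2));
  rewrite h mulr0.
Qed.

Lemma pair_sum_inJ psi l : (forall u v x y, pair_sum psi (ctx u v (rel_terms x y)) = 0) ->
  inJ par (ev l) -> pair_sum psi l = 0.
Proof. by move=> h /inJ_terms[l' e hl']; rewrite (pair_sum_ev_eq psi e) hl'. Qed.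

End Congruence.

(** * Splitting a list at one entry; induction on adjacent transpositions *)

Section Splits.
Variable T : eqType.
Implicit Types s : seq T.

Fixpoint splits s : seq (seq T * T * seq T) :=
  if s is x :: s' then
    ([::], x, s') :: [seq (x :: t.1.1, t.1.2, t.2) | t <- splits s']
  else [::].

Lemma splitsP s t : t \in splits s -> s = t.1.1 ++ t.1.2 :: t.2.
Proof.
elim: s t => //= x s IH t; rewrite inE => /predU1P[-> //|/mapP[t' /IH e ->]] /=.
by rewrite -e.
Qed.

Lemma splits_cat s1 s2 : splits (s1 ++ s2) =
  [seq (t.1.1, t.1.2, t.2 ++ s2) | t <- splits s1]
  ++ [seq (s1 ++ t.1.1, t.1.2, t.2) | t <- splits s2].
Proof.
elim: s1 => /= [|x s1 ->]; first by rewrite -[LHS]map_id; apply: eq_map => -[[]].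
by rewrite map_cat -!map_comp.
Qed.

Lemma perm_splits s t : t \in splits s -> perm_eq s (t.1.2 :: t.1.1 ++ t.2).
Proof. by move/splitsP=> ->; rewrite perm_catC /= perm_cons perm_catC. Qed.

(** The tail of [s] is related by induction to [s'] deprived of the head [x]; swaps with its left
    neighbours then carry [x] to its place in [s']. *)
Lemma perm_swap_ind (E : seq T -> seq T -> Prop) :
  (forall s, E s s) -> (forall s2 s1 s3, E s1 s2 -> E s2 s3 -> E s1 s3) ->
  (forall x s s', E s s' -> E (x :: s) (x :: s')) ->
  (forall x y s, E (x :: y :: s) (y :: x :: s)) ->
  forall s s', perm_eq s s' -> E s s'.
Proof.
move=> Er Et Ec Es; elim=> [|x s IH] s' p.
  by move: p; rewrite perm_sym => /perm_nilP ->.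
have xs' : x \in s' by rewrite -(perm_mem p) mem_head.
case/splitPr: xs' p => a b p.
have IH' : E s (a ++ b); last move: IH'.
  by apply: IH; rewrite -(perm_cons x) (perm_trans p) // perm_catC /= perm_cons perm_catC.
move/(Ec x)/Et; apply; elim: a {p} => //= y a IHa.
by apply: Et (Es _ _ _) _; apply: Ec.
Qed.

End Splits.

(** * The tensor module and its matrix coefficients *)

Section TensorModule.
Variables (R : comNzRingType) (Sym : eqType) (par : Sym -> bool).
Local Notation X := (Sym * Sym)%type.
Local Notation T := (bool * Sym)%type.
Implicit Types (x y : X) (w : seq X) (v : seq T) (F G : seq T -> R).

(* The free module on words over [T] is the tensor algebra of two copies of
   the defining representation, on which e_{a,b} (f, c) = d_{bc} (false, a):
   the flag records that a letter has not been acted on yet.  [ract x F] is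
   the functional v |-> F (x . v). *)
Fixpoint ract x F v : R :=
  if v is t :: v' then
    (x.2 == t.2)%:R * F ((false, x.1) :: v')
    + (if gpar par x && par t.2 then -1 else 1) * ract x (fun u => F (t :: u)) v'
  else 0.

Lemma ract_lin x a b F G v :
  ract x (fun u => a * F u + b * G u) v = a * ract x F v + b * ract x G v.
Proof.
elim: v F G => [|t v IH] F G /=; first by rewrite !mulr0 addr0.
by rewrite IH; ring.
Qed.

(** Since [ract y (ract x F)] is v |-> F (x . (y . v)), this is the superbracket relation in the
    module. Terms where one letter acts on the head of v and the other on the tail cancel in
    pairs. *)
Lemma ract_comm x y F v :
  ract y (ract x F) v - sgn R par x y * ract x (ract y F) v =
  (x.2 == y.1)%:R * ract (x.1, y.2) F v
  - sgn R par x y * (x.1 == y.2)%:R * ract (y.1, x.2) F v.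
Proof.
elim: v F => [|t v IH] F /=; first by rewrite !mulr0 subrr.
rewrite !ract_lin; move/(_ (fun u => F (t :: u)))/(canRL (subrK _)): IH => ->.
case: x y t => [x1 x2] [y1 y2] [f t] /=.
move: (ract _ (ract _ _) v) (ract (x1, y2) _ v) (ract (y1, x2) _ v) => yx A B.
move: (ract (x1, x2) _ v) (ract (y1, y2) _ v) (F _) (F _) => A' B' C D.
rewrite /sgn /gpar /= (eq_sym y2 x1).
(* A nonzero Kronecker delta equates two parities; with these equations the signs reduce to a finite
   case check. *)
have e1 : (x1 == y2) -> par x1 = par y2 by move/eqP->.
have e2 : (x2 == y1) -> par x2 = par y1 by move/eqP->.
have e3 : (x2 == t) -> par x2 = par t by move/eqP->.
have e4 : (y2 == t) -> par y2 = par t by move/eqP->.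
move: (par x1) (par x2) (par y1) (par y2) (par t) e1 e2 e3 e4 => p1 p2 q1 q2 pt.
case: (x1 == y2) => [/(_ isT) ->|_]; case: (x2 == y1) => [/(_ isT) ->|_];
  case: (x2 == t) => [/(_ isT) e|_]; case: (y2 == t) => [/(_ isT) e'|_];
  rewrite ?mul0r ?mul1r ?mulr0 ?mulr1 ?add0r ?addr0 ?subr0 ?sub0r ?mulN1r;
  try (move: e); try (move: e').
all: try by [].
all: destruct p1, p2, q1, q2, pt => //= *; rewrite ?mul1r ?mulN1r ?opprK; try by [].
all: ring.
Qed.

(** A word v' occurring in x . v is v with one letter [x.2] replaced by [x.1], which lowers at most
    one flag. The last clause expresses the replacement without subtraction. *)
Lemma ract_neq0 x F v : ract x F v != 0 -> exists v', [/\ F v' != 0,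
  x.2 \in map snd v, (count (fun t => t.1) v <= (count (fun t => t.1) v').+1)%N &
  forall g, (count (pred1 g) (map snd v') + (x.2 == g) =
             count (pred1 g) (map snd v) + (x.1 == g))%N].
Proof.
elim: v F => [|t v IH] F /=; first by rewrite eqxx.
have [e|ne] := eqVneq (x.2) t.2; last first.
  rewrite mul0r add0r => h.
  have /IH[v' [h1 h2 h3 h4]] : ract x (fun u => F (t :: u)) v != 0.
    by apply: contraNneq h => ->; rewrite mulr0.
  exists (t :: v'); split => //; first by rewrite inE h2 orbT.
    by rewrite /= -addnS leq_add2l.
  by move=> g; rewrite /= -!addnA h4.
have [|h _] := eqVneq (F ((false, x.1) :: v)) 0; last first.
  exists ((false, x.1) :: v); split => //=.
  - by rewrite inE e eqxx.
  - by rewrite add0n -add1n leq_add2r leq_b1.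
  - by move=> g; rewrite e; lia.
move=> ->; rewrite mulr0 add0r => h.
have /IH[v' [h1 h2 h3 h4]] : ract x (fun u => F (t :: u)) v != 0.
  by apply: contraNneq h => ->; rewrite mulr0.
exists (t :: v'); split => //; first by rewrite inE e eqxx.
  by rewrite /= -addnS leq_add2l.
by move=> g; rewrite /= -!addnA h4.
Qed.

(** The functional v |-> F (w . v): [ract] being contravariant, the last letter of [w] is the first
    to act on v. *)
Definition actw F w : seq T -> R := foldl (fun G x => ract x G) F w.

Lemma actw_cat F w w' : actw F (w ++ w') = actw (actw F w) w'.
Proof. exact: foldl_cat. Qed.

Lemma actw_rcons F w x : actw F (rcons w x) = ract x (actw F w).
Proof. exact: foldl_rcons. Qed.

Lemma actw_lin w a b F G v :
  actw (fun u => a * F u + b * G u) w v = a * actw F w v + b * actw G w v.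
Proof.
elim: w F G => [|x w IH] F G //=; rewrite -IH; congr actw.
by apply/funext => u; rewrite ract_lin.
Qed.

Lemma actw_rel F v0 u w x y :
  pair_sum (fun z => actw F z v0) (ctx u w (rel_terms R par x y)) = 0.
Proof.
rewrite /pair_sum /ctx /rel_terms !big_cons big_nil /= !actw_cat /=.
move: (actw F u) => G; rewrite addr0.
set s := sgn R par x y.
transitivity (actw (fun z => 1 * (1 * ract y (ract x G) z + (- s) * ract x (ract y G) z)
  + 1 * ((- (x.2 == y.1)%:R) * ract (x.1, y.2) G z
         + (s * (x.1 == y.2)%:R) * ract (y.1, x.2) G z)) w v0).
  by rewrite !actw_lin; ring.
transitivity (actw (fun z => 0 * G z + 0 * G z) w v0); last by rewrite actw_lin !mul0r addr0.
congr actw; apply/funext => z.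
by have := ract_comm x y G z; rewrite -/s => /(canRL (subrK _)) ->; ring.
Qed.

(** [rev w] lists the letters in order of action. If w . v contributes, every [g] consumed so far
    was either present in [v] or created by an earlier letter. *)
Lemma actw_count F w v g k : actw F w v != 0 -> (k < size w)%N ->
  (count (fun x => x.2 == g) (take k.+1 (rev w)) <=
   count (pred1 g) (map snd v) + count (fun x => x.1 == g) (take k (rev w)))%N.
Proof.
elim/last_ind: w v k => [|w x IH] v k //; rewrite actw_rcons rev_rcons size_rcons.
case/ract_neq0=> v' [h1 h2 _ /(_ g) h4]; case: k => [_|k] /=.
  rewrite take0 !addn0.
  by case: eqP h2 => //= <-; rewrite -has_pred1 has_count.
by rewrite ltnS => /(IH _ _ h1); lia.
Qed.

(** Each letter of [w] lowers at most one flag, so some flag stays up, and [F] vanishes there. *)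
Lemma actw_flags F w v : (forall u, (0 < count (fun t => t.1) u)%N -> F u = 0) ->
  (size w < count (fun t => t.1) v)%N -> actw F w v = 0.
Proof.
move=> hF; elim/last_ind: w v => [|w x IH] v; first exact: hF.
rewrite actw_rcons size_rcons => lt; apply/eqP.
apply: contraTT lt => /ract_neq0[v' [h1 _ h3 _]].
rewrite -leqNgt (leq_trans h3) // ltnS leqNgt.
by apply: contraNN h1 => /IH ->.
Qed.

End TensorModule.

(** * Counting the matchings between two words *)

Section Matching.
Variable T : eqType.
Implicit Types s w : seq T.

(** The number of letter-preserving injections from the positions of [s] to those of [w]; the first
    position has [count_mem x w] possible images. *)
Fixpoint nmatch s w : nat :=
  if s is x :: s' then (count_mem x w * nmatch s' (rem x w))%N else 1%N.

Lemma perm_rem x w w' : perm_eq w w' -> perm_eq (rem x w) (rem x w').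
Proof.
move=> p; have [xw|nxw] := boolP (x \in w); last first.
  by rewrite !rem_id // -(perm_mem p).
rewrite -(perm_cons x) -(permPl (perm_to_rem xw)) (permPl p).
by apply: perm_to_rem; rewrite -(perm_mem p).
Qed.

Lemma perm_nmatch s w w' : perm_eq w w' -> nmatch s w = nmatch s w'.
Proof.
elim: s w w' => //= x s IH w w' p.
by rewrite (IH _ _ (perm_rem x p)); move/seq.permP: p => ->.
Qed.

Lemma nmatch_gt0 s w : size w = size s -> (0 < nmatch s w)%N = perm_eq w s.
Proof.
elim: s w => [|x s IH] w /= sz; first by case: w sz.
rewrite muln_gt0 -has_count has_pred1; have [xw|nxw] /= := boolP (x \in w).
  rewrite IH ?size_rem ?sz //.
  by rewrite (permPl (perm_to_rem xw)) perm_cons.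
by apply/esym; apply: contraNF nxw => /perm_mem ->; rewrite mem_head.
Qed.

End Matching.

(** * Matrix coefficients from V'^{(x)h} to V^{(x)h} *)

Section SymbolPairing.
Variables (R : comNzRingType) (Sym : eqType) (par : Sym -> bool).
Local Notation X := (Sym * Sym)%type.
Local Notation T := (bool * Sym)%type.
Local Notation actw := (@actw R Sym par).
Local Notation ract := (@ract R Sym par).
Local Notation even := (fun x => ~~ gpar par x).
Implicit Types (x y : X) (w s : seq X) (v : seq T) (F G : seq T -> R).

Definition tens (c : T) F v : R := if v is t :: v' then (t == c)%:R * F v' else 0.

Definition dual_word (I : seq Sym) v : R := (v == map (pair false) I)%:R.

Definition pairing s w : R :=
  actw (dual_word (map fst s)) w (map (pair true) (map snd s)).

Lemma dual_word_cons i I : dual_word (i :: I) = tens (false, i) (dual_word I).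
Proof.
apply/funext => -[|t v] //=; rewrite /dual_word /= eqseq_cons.
by case: eqP => _ /=; rewrite ?mul1r ?mul0r.
Qed.

Lemma dual_word_flags I v : (0 < count (fun t => t.1) v)%N -> dual_word I v = 0.
Proof.
rewrite /dual_word; case: eqP => [->|//].
by rewrite count_map (eq_count (a2 := pred0)) ?count_pred0.
Qed.

(** The action never raises a flag, so a head that must end as [(true, c)] was left alone; [x] being
    even, it passes to the tail without sign. *)
Lemma ract_tens_touched x c F : even x ->
  ract x (tens (true, c) F) = tens (true, c) (ract x F).
Proof.
move=> /negPf ex; apply/funext => -[|t v] //=; rewrite ex /= mul0r mulr0 add0r mul1r.
have := ract_lin par x (t == (true, c))%:R 0 F F v; rewrite mul0r addr0 => <-.
by congr ract; apply/funext => u; rewrite mul0r addr0.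
Qed.

Lemma ract_tens x c F : even x ->
  ract x (tens (false, c) F) = fun v =>
    (x.1 == c)%:R * (tens (false, x.2) F v + tens (true, x.2) F v)
    + tens (false, c) (ract x F) v.
Proof.
move=> /negPf ex; apply/funext => -[|[f t] v] /=; rewrite ?mulr0 ?addr0 ?mulr0 //.
rewrite ex /= mul1r !xpair_eqE /= (eq_sym x.2); congr (_ + _).
  by case: f (x.1 == c) (t == x.2) => -[] [] /=; ring.
have := ract_lin par x ((f, t) == (false, c))%:R 0 F F v; rewrite mul0r addr0 => <-.
by congr ract; apply/funext => u; rewrite mul0r addr0.
Qed.

Lemma actw_tens_touched w c F : all even w ->
  actw (tens (true, c) F) w = tens (true, c) (actw F w).
Proof.
by elim: w F => //= x w IH F /andP[ex ew]; rewrite ract_tens_touched // IH.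
Qed.

Lemma actw_tens_cons x w c F v : all even (x :: w) ->
  actw (tens (false, c) F) (x :: w) v =
  (x.1 == c)%:R * (actw (tens (false, x.2) F) w v + tens (true, x.2) (actw F w) v)
  + actw (tens (false, c) (ract x F)) w v.
Proof.
case/andP=> ex ew; rewrite -actw_tens_touched //= ract_tens //.
set A := tens (false, x.2) F; set B := tens (true, x.2) F; set C := tens _ (ract x F).
transitivity (actw (fun u => (x.1 == c)%:R * (1 * A u + 1 * B u) + 1 * C u) w v).
  by congr actw; apply/funext => u; rewrite !mul1r.
by rewrite !actw_lin !mul1r.
Qed.

(** The tail needs at least [k] letters and the flagged head one more, so [k] letters do not
    suffice. *)
Lemma actw_tens_short w c t F v k : all even w ->
  (forall u, all even u -> (size u < k)%N -> actw F u v = 0) -> (size w <= k)%N ->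
  actw (tens (false, c) F) w ((true, t) :: v) = 0.
Proof.
elim: w c F k => [|x w IH] c F k ew hF sz; first by rewrite /= mul0r.
rewrite actw_tens_cons //; case/andP: ew => ex ew; case: k hF sz => // k hF sz.
rewrite (IH _ _ _ ew hF (ltnW sz)) /= (hF w ew sz) mulr0 addr0 mulr0 add0r.
apply: (IH _ _ k ew _ sz) => u eu su; apply: (hF (x :: u)) => //=; first by rewrite ex.
Qed.

(** With [k.+1] letters exactly one can be spent on the head, as the tail needs the other [k]. That
    letter has to turn [t] into [c], hence is e_{c,t}. *)
Lemma actw_tens_split w c t F v k : all even w ->
  (forall u, all even u -> (size u < k)%N -> actw F u v = 0) -> size w = k.+1 ->
  actw (tens (false, c) F) w ((true, t) :: v) =
  \sum_(q <- splits w) (q.1.2 == (c, t))%:R * actw F (q.1.1 ++ q.2) v.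
Proof.
elim: w c F k => [|x w IH] c F k ew hF //= [sz].
rewrite -[LHS]/(actw (tens (false, c) F) (x :: w) _) actw_tens_cons //.
case/andP: ew => ex ew; rewrite (actw_tens_short _ _ ew hF) ?sz // add0r big_cons big_map /=.
congr (_ + _).
  rewrite mulrA -natrM mulnb; congr (_%:R * _); congr nat_of_bool.
  by case: (x) => x1 x2; rewrite !xpair_eqE /= (eq_sym t).
case: k hF sz => [|k] hF sz; first by case: w sz {IH ew} => //= _; rewrite mul0r big_nil.
apply: (IH _ _ k ew _ sz) => u eu su; apply: (hF (x :: u)) => //=; first by rewrite ex.
Qed.

Lemma pairing_short s w : (size w < size s)%N -> pairing s w = 0.
Proof.
move=> lt; apply: actw_flags; first exact: dual_word_flags.
by rewrite count_map (eq_count (a2 := predT)) ?count_predT ?size_map.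
Qed.

(** Any occurrence of the first pair of [s] in [w] may act on the first tensor factor; each choice
    leaves the same word up to permutation, which gives the recursion of [nmatch]. *)
Lemma pairing_eq s w : all even w -> size w = size s ->
  pairing s w = (nmatch s w)%:R.
Proof.
elim: s w => [|[c t] s IH] w ew sz; first by case: w sz {ew}.
rewrite /pairing /= dual_word_cons (@actw_tens_split _ _ _ _ _ (size s)) //; last first.
  by move=> u eu su; apply: pairing_short.
rewrite natrM -sum1_count natr_sum mulr_suml.
have -> : \sum_(x <- w | pred1 (c, t) x) 1%:R * (nmatch s (rem (c, t) w))%:R =
  \sum_(q <- splits w | q.1.2 == (c, t)) (nmatch s (rem (c, t) w))%:R :> R.
  have {1}-> : w = map (fun q => q.1.2) (splits w).
    by elim: (w) => //= x w' {1}->; rewrite -map_comp.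
  by rewrite big_map; apply: eq_bigr => q _; rewrite mul1r.
rewrite [RHS]big_mkcond /=; apply: eq_big_seq => q qw.
case: eqP => e; last by rewrite mul0r.
have pw := perm_splits qw; rewrite mul1r; move: (pw); rewrite e => pw'.
have ewq : all even (q.1.1 ++ q.2).
  by move: ew; rewrite (perm_all _ pw) /= => /andP[].
have szq : size (q.1.1 ++ q.2) = size s.
  by move: (perm_size pw); rewrite sz => -[].
rewrite -/(pairing s _) IH //; congr (_%:R); apply: perm_nmatch.
by rewrite perm_sym -(perm_cons (c, t)) -(permPr pw') perm_sym perm_to_rem
  // (perm_mem pw') mem_head.
Qed.

End SymbolPairing.

(** * A criterion for membership in J, through the spanning half of Poincare-Birkhoff-Witt *)

Section Triangular.
Variables (R : numDomainType) (Sym : countType) (par : Sym -> bool).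
Hypothesis even_par : forall x, gpar par x = false.
Local Notation X := (Sym * Sym)%type.
Implicit Types (x y : X) (u w s : seq X) (l : seq (R * seq X)).

Definition eqJ l l' := inJ par ((ev l : seq X -> R) - ev l').

Lemma eqJ_refl l : eqJ l l.
Proof. by rewrite /eqJ subrr; apply: inJ0. Qed.

Lemma eqJ_trans l2 l1 l3 : eqJ l1 l2 -> eqJ l2 l3 -> eqJ l1 l3.
Proof. by move=> h /(inJD h); rewrite addrA subrK. Qed.

Lemma eqJ_cat l1 l1' l2 l2' : eqJ l1 l1' -> eqJ l2 l2' -> eqJ (l1 ++ l2) (l1' ++ l2').
Proof. by move=> h /(inJD h); rewrite addrACA -opprD -!ev_cat. Qed.

Lemma eqJ_scl c l l' : eqJ l l' -> eqJ (scl c l) (scl c l').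
Proof.
move/(inJZ c); congr inJ; apply/funext => w.
by rewrite /= mulrBr -!ev_scl.
Qed.

Lemma eqJ_swap u w x y : eqJ [:: (1, u ++ x :: y :: w)]
  ((1, u ++ y :: x :: w) :: ctx u [::] [:: ((x.2 == y.1)%:R, (x.1, y.2) :: w);
                                    (- (x.1 == y.2)%:R, (y.1, x.2) :: w)]).
Proof.
have := @inJ_rel R Sym par u x y w; congr inJ; apply/funext => v.
rewrite !fctE /ev /ctx /rel_terms /sgn even_par /= !cats0.
by rewrite !big_cons !big_nil /=; ring.
Qed.

Lemma eqJ_perm w w' : perm_eq w w' -> exists2 low, all (fun t => size t.2 < size w)%N low &
  forall u, eqJ [:: (1, u ++ w)] ((1, u ++ w') :: ctx u [::] low).
Proof.
(* The correction [low] does not depend on the prefix [u], which makes [E] stable under adding a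
   common head. *)
pose E w w' := size w = size w' /\ exists2 low, all (fun t => size t.2 < size w)%N low &
  forall u, eqJ [:: (1, u ++ w)] ((1, u ++ w') :: ctx u [::] low).
suff: perm_eq w w' -> E w w' by move=> h /h[].
apply: perm_swap_ind.
- by move=> s; split=> //; exists [::] => // u; apply: eqJ_refl.
- move=> s2 s1 s3 [z12 [low1 a1 h1]] [z23 [low2 a2 h2]]; split; first by rewrite z12.
  exists (low2 ++ low1); first by rewrite all_cat a1 z12 a2.
  move=> u; apply: eqJ_trans (h1 u) _; rewrite /ctx map_cat -!/(ctx _ _ _).
  exact: (eqJ_cat (h2 u) (eqJ_refl (ctx u [::] low1))).
- move=> x s s' [z [low a h]]; split; first by rewrite /= z.
  exists (ctx [:: x] [::] low).
    by rewrite all_map; apply: sub_all a => t /=; rewrite cats0.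
  by move=> u; rewrite ctx_ctx; have := h (u ++ [:: x]); rewrite -!catA.
- move=> x y s; split=> //.
  exists [:: ((x.2 == y.1)%:R, (x.1, y.2) :: s); (- (x.1 == y.2)%:R, (y.1, x.2) :: s)].
    by rewrite /= !ltnS !leqnn.
  by move=> u; apply: eqJ_swap.
Qed.

Definition word_le x y := (pickle x <= pickle y)%N.

Definition sortw : seq X -> seq X := sort word_le.

Lemma sortwP w w' : reflect (sortw w = sortw w') (perm_eq w w').
Proof.
apply: perm_sortP; first by move=> x y; apply: leq_total.
  by move=> y x z; apply: leq_trans.
by move=> x y; rewrite -eqn_leq => /eqP; apply: (pcan_inj pickleK).
Qed.

(** Words of top length [h] commute up to shorter ones, so each can be replaced by its sorted
    form. *)
Lemma eqJ_sort h l : all (fun t => size t.2 < h.+1)%N l ->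
  exists2 low, all (fun t => size t.2 < h)%N low &
  eqJ l ([seq (t.1, sortw t.2) | t <- l & size t.2 == h] ++ low).
Proof.
elim: l => [|[c w] l IH] /=; first by exists [::] => //; apply: eqJ_refl.
case/andP=> sw /IH[low a e]; have [sh|nsh] := eqVneq (size w) h; last first.
  exists ((c, w) :: low) => /=; first by rewrite a andbT ltn_neqAle nsh -ltnS.
  have := eqJ_cat (eqJ_refl [:: (c, w)]) e; congr inJ; congr (_ - _).
  rewrite -[(c, w) :: low]/([:: (c, w)] ++ low) -cat1s; move: [:: (c, w)] => cw.
  by rewrite !ev_cat addrCA.
have pw : perm_eq w (sortw w) by rewrite perm_sym perm_sort.
have [low' a' /(_ [::]) /(eqJ_scl c) e'] := eqJ_perm pw; exists (low ++ scl c low').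
  by rewrite all_cat a /scl all_map -sh.
have := eqJ_cat e' e; congr inJ; rewrite /= mulr1; congr (_ - _).
have -> : ctx [::] [::] low' = low'.
  by rewrite -[RHS]map_id; apply: eq_map => -[c' w'] /=; rewrite cats0.
rewrite -[in LHS]cat1s -[in RHS]cat1s !ev_cat.
by congr (_ + _); rewrite addrC -!addrA.
Qed.

(* Sorting the words of maximal length modulo shorter ones groups their
   coefficients into sums over permutation classes, which [psi] shows to vanish. *)
Lemma triangular_inJ (psi : seq X -> seq X -> R) l :
  (forall s u v x y, pair_sum (psi s) (ctx u v (rel_terms R par x y)) = 0) ->
  (forall s w, (size w < size s)%N -> psi s w = 0) ->
  (forall s w, size w = size s -> psi s w = (nmatch s w)%:R) ->
  (forall s, pair_sum (psi s) l = 0) -> inJ par (ev l).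
Proof.
move=> prel pshort peq.
have [h] : exists h, all (fun t => size t.2 < h)%N l.
  elim: l => [|t l [h hh]]; first by exists 0%N.
  exists (maxn (size t.2).+1 h) => /=; rewrite leq_maxl /=.
  by apply: sub_all hh => q hq; rewrite (leq_trans hq) ?leq_maxr.
elim: h l => [|h IH] l hl p0.
  by case: l hl {p0} => // _; rewrite ev_nil; apply: inJ0.
have [low a e] := eqJ_sort hl; move: e; rewrite /eqJ ev_cat.
have -> : ev [seq (t.1, sortw t.2) | t <- l & size t.2 == h] = (0 : seq X -> R).
  apply: ev_coef0 => v; rewrite big_map big_filter_cond /=.
  have [/hasP[t0 t0l /andP[/eqP s0 /eqP v0]]|nh] :=
    boolP (has (fun t => (size t.2 == h) && (sortw t.2 == v)) l); last first.
    rewrite big_seq_cond big1 // => t /andP[tl ht].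
    by move/hasPn: nh => /(_ t tl); rewrite ht.
  have vs : size v = h by rewrite -v0 size_sort.
  have pv w : (sortw w == v) = perm_eq w v.
    rewrite -v0; apply/eqP/idP => [/sortwP /permPl -> | pw].
      by rewrite perm_sym perm_sort.
    by apply/sortwP; rewrite (permPl pw) perm_sort.
  (* The coefficient sum over the class of [v], times this number, is the pairing of [l] with [v],
     which is zero. Characteristic zero allows the cancellation. *)
  have nv : (nmatch v v)%:R != 0 :> R by rewrite pnatr_eq0 -lt0n nmatch_gt0.
  apply: (mulIf nv); rewrite mul0r -[RHS](p0 v) /pair_sum mulr_suml big_mkcond /=.
  apply: eq_big_seq => t tl; rewrite pv.
  have st : (size t.2 <= h)%N by move/allP: hl => /(_ t tl).
  have [st'|st'] := eqVneq (size t.2) h; last first.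
    by rewrite pshort ?mulr0 // vs ltn_neqAle st'.
  rewrite peq ?vs //=; have [p|np] := boolP (perm_eq _ _); first by rewrite (perm_nmatch _ p).
  have := nmatch_gt0 (etrans st' (esym vs)); rewrite (negPf np) lt0n => /negbFE /eqP ->.
  by rewrite mulr0.
(* Being congruent to [l], the shorter sum [low] has the same vanishing pairings, so induction
   applies. *)
rewrite add0r => e; suff /(inJD e): inJ par (ev low) by rewrite subrK.
apply: IH => // s; rewrite -[RHS](p0 s); apply/eqP; rewrite eq_sym -subr_eq0 -mulN1r.
rewrite -pair_sum_scl -pair_sum_cat; apply/eqP; apply: pair_sum_inJ (prel s) _.
by move: e; congr inJ; rewrite ev_cat; congr (_ + _); apply/funext => w; rewrite ev_scl mulN1r.
Qed.

End Triangular.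

(** * Embedding words in proper symbols *)

Section Embedding.
Variables (R : comNzRingType) (m0 m1 n : nat).
Local Notation SX := (ssym m0 m1 n * ssym m0 m1 n)%type.
Local Notation LX := ('I_n * 'I_n)%type.

Definition emb (x : LX) : SX := (psym m0 m1 x.1, psym m0 m1 x.2).

Lemma embK : pcancel emb (@unemb m0 m1 n).
Proof. by case. Qed.

Lemma unembK x y : unemb x = Some y -> x = emb y.
Proof. by case: x => [[?|[?|i]] [?|[?|j]]] //= [<-]. Qed.

Lemma all_unemb w : all (fun x => @unemb m0 m1 n x != None) (map emb w).
Proof. by rewrite all_map; apply/allP. Qed.

Lemma embedF_emb (f : ser R LX) w : @embedF R m0 m1 n f (map emb w) = f w.
Proof. by rewrite /embedF all_unemb (map_pK embK). Qed.

Lemma embedF_ev (l : seq (R * seq LX)) :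
  @embedF R m0 m1 n (ev l) = ev [seq (t.1, map emb t.2) | t <- l].
Proof.
apply/funext => w; rewrite /embedF /ev big_map /=.
have [/allP aw|/negP nw] := boolP (all _ w); last first.
  rewrite big1 // => t _; rewrite /sword; case: eqP => [e|_]; last by rewrite mulr0.
  by case: nw; rewrite e all_unemb.
have {2}-> : w = map emb (pmap (@unemb m0 m1 n) w).
  elim: w aw => //= x w IH aw; have := aw x (mem_head _ _).
  case e: (unemb x) => [y|] //= _; rewrite -(unembK e) -IH // => z zw.
  by apply: aw; rewrite inE zw orbT.
apply: eq_bigr => t _; rewrite /sword (inj_eq (inj_map (pcan_inj embK))) //.
Qed.

End Embedding.

(** * U(gl(n)) meets Irr trivially *)

Section Directness.
Variables (R : numDomainType) (m0 m1 n : nat).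
Local Notation SX := (ssym m0 m1 n * ssym m0 m1 n)%type.
Local Notation LX := ('I_n * 'I_n)%type.
Local Notation emb := (@emb m0 m1 n).

(** A vector in proper symbols offers no virtual symbol to consume, whereas an irregular word
    consumes some virtual symbol more often than it has created it. *)
Lemma actw_irregular F w (v : seq (bool * ssym m0 m1 n)) :
  irregular w -> {in map snd v, forall g, ~~ virtual g} -> actw (@parS m0 m1 n) F w v = 0 :> R.
Proof.
case/existsP=> k /existsP[g /andP[vg lt]] hv; apply/eqP; apply: contraTT lt => nz.
rewrite -leqNgt (leq_trans (actw_count g nz (ltn_ord k))) //.
have -> : count (pred1 g) (map snd v) = 0%N.
  apply/eqP; rewrite -leqn0 leqNgt -has_count has_pred1.
  by apply: contraL vg => /hv.
by rewrite add0n.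
Qed.

(** The pairings with embedded words vanish on J and on Irr, hence on [f]; restricted to proper
    symbols they satisfy the hypotheses of [triangular_inJ]. *)
Lemma inIrr_embedF (f : ser R LX) : inIrr (@embedF R m0 m1 n f) -> inJ (@parL n) f.
Proof.
case=> lI [irrI /inJ_terms[lJ eJ hJ]].
pose q := [seq (t.1.1, t.1.2 ++ t.2) | t <- lI] ++ lJ.
have eq_q : @embedF R m0 m1 n f = ev q.
  apply/funext => w; have := congr1 (fun g => g w) eJ => /= /(canRL (subrK _)) ->.
  by rewrite addrC /ev big_cat big_map.
(* The support of [f] is finite: it lies among the words of [q] pulled back by [unemb]. *)
have fE : f = ev [seq (f w, w) | w <- undup (map (pmap (@unemb m0 m1 n)) (map snd q))].
  apply: finite_ev => w; rewrite -(@embedF_emb R m0 m1) eq_q => /ev_neq0_mem /(map_f (pmap (@unemb m0 m1 n))).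
  by rewrite (map_pK (@embK _ _ _)).
move: fE; set l := map _ _ => fE; rewrite fE.
pose embl := [seq (t.1, map emb t.2) | t <- l].
pose psi s w := pairing R (@parS m0 m1 n) (map emb s) (map emb w).
have psi_emb s l' : pair_sum (psi s) l' =
    pair_sum (pairing R (@parS m0 m1 n) (map emb s)) [seq (t.1, map emb t.2) | t <- l'].
  by rewrite /pair_sum big_map.
have embi : injective emb := pcan_inj (@embK _ _ _).
apply: (@triangular_inJ R 'I_n (@parL n) _ psi).
- by [].
- move=> s u v x y; rewrite psi_emb.
  have -> : [seq (t.1, map emb t.2) | t <- ctx u v (rel_terms R (@parL n) x y)] =
      ctx (map emb u) (map emb v) (rel_terms R (@parS m0 m1 n) (emb x) (emb y)).
    by rewrite /ctx /rel_terms /= !map_cat.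
  exact: actw_rel.
- by move=> s w lt; rewrite /psi pairing_short // !size_map.
- move=> s w sz; rewrite /psi pairing_eq ?size_map //; last by rewrite all_map; apply/allP.
  congr (_%:R); elim: s w {sz} => //= x s IH w; rewrite -IH; congr (_ * _)%N.
    by rewrite count_map; apply: eq_count => y /=; rewrite (inj_eq embi).
  by congr nmatch; elim: w => //= y w IHw; rewrite (inj_eq embi) (fun_if (map emb)) /= IHw.
- move=> s; rewrite psi_emb -/embl.
  have <- : pair_sum (pairing R (@parS m0 m1 n) (map emb s)) q = 0.
    rewrite /q pair_sum_cat hJ ?addr0; last by move=> *; apply: actw_rel.
    rewrite /pair_sum big_map big_seq big1 // => t tl /=.
    (* The irregular factor stands on the right, so it meets the proper vector first, whatever
       functional the left factor produces. *)
    rewrite /pairing actw_cat actw_irregular ?mulr0 //; first by move/allP: irrI => /(_ t tl).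
    move=> g; rewrite -!map_comp => /mapP[x _ ->] //.
  by apply: pair_sum_ev_eq; rewrite -eq_q -embedF_ev -fE.
Qed.

End Directness.

(** * Contractions of a list of pairs *)

Section Contraction.
Variables (L T : eqType).

(** The terms of e_{ij} acting as a derivation on first components. The second components may be
    column indices or beta labels. *)
Fixpoint contract (i j : L) (s : seq (L * T)) : seq (seq (L * T)) :=
  if s is x :: s' then
    (if x.1 == j then [:: (i, x.2) :: s'] else [::]) ++ [seq x :: t | t <- contract i j s']
  else [::].

Lemma size_contract i j s t : t \in contract i j s -> size t = size s.
Proof.
elim: s t => //= x s IH t; rewrite mem_cat => /orP[|/mapP[t' /IH e ->] /=].
  by case: ifP => //; rewrite inE => _ /eqP ->.
by rewrite e.
Qed.

End Contraction.

Lemma sum_contract (V : nmodType) (L T : eqType) (i j : L) (x : L * T) s (K : seq (L * T) -> V) :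
  \sum_(t <- contract i j (x :: s)) K t =
  (if x.1 == j then K ((i, x.2) :: s) else 0) + \sum_(t <- contract i j s) K (x :: t).
Proof. by rewrite /= big_cat big_map /=; case: ifP; rewrite ?big_seq1 ?big_nil. Qed.

(** * Sums over label-preserving bijections *)

Section Pairings.
Variables (L T : eqType) (V : zmodType).
Implicit Types (P : seq (L * T)) (c : seq (T * L)) (K : seq (L * L) -> V).

(* The sum of [K] over all bijections from [P] to [c] that respect the labels
   in [T], each bijection being recorded as the list of its matched pairs. *)
Fixpoint matchings P c K : V :=
  if P is p :: P' then
    \sum_(q <- splits c | q.1.2.1 == p.2)
      matchings P' (q.1.1 ++ q.2) (fun s => K ((p.1, q.1.2.2) :: s))
  else K [::].

Lemma eq_matchings P c K K' : (forall s, size s = size P -> K s = K' s) ->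
  matchings P c K = matchings P c K'.
Proof.
elim: P c K K' => [|p P IH] c K K' h /=; first exact: h.
by apply: eq_bigr => q _; apply: IH => s sz; apply: h; rewrite /= sz.
Qed.

Lemma matchingsD P c K K' :
  matchings P c (fun s => K s + K' s) = matchings P c K + matchings P c K'.
Proof.
elim: P c K K' => [|p P IH] c K K' //=.
by rewrite -big_split; apply: eq_bigr => q _; rewrite IH.
Qed.

Lemma matchings0 P c : matchings P c (fun=> 0) = 0.
Proof. by elim: P c => //= p P IH c; rewrite big1. Qed.

Lemma matchingsB P c K K' :
  matchings P c (fun s => K s - K' s) = matchings P c K - matchings P c K'.
Proof.
by apply/eqP; rewrite eq_sym subr_eq -matchingsD; apply/eqP/eq_matchings => s _; rewrite subrK.
Qed.

(** Matching looks only at the labels of [P], contraction changes only its first components; the two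
    therefore commute. *)
Lemma matchings_contract i j P c K :
  \sum_(P' <- contract i j P) matchings P' c K =
  matchings P c (fun s => \sum_(s' <- contract i j s) K s').
Proof.
elim: P c K => [|p P IH] c K; first by rewrite /= !big_nil.
rewrite sum_contract /=.
under [RHS]eq_bigr => q _.
  rewrite (@eq_matchings P _ _ (fun s =>
      (if p.1 == j then K ((i, q.1.2.2) :: s) else 0)
      + \sum_(s' <- contract i j s) K ((p.1, q.1.2.2) :: s'))); last first.
    by move=> s _; rewrite sum_contract.
  rewrite matchingsD -IH; over.
rewrite big_split /= [in RHS]exchange_big /=; congr (_ + _).
by case: ifP => _ //; rewrite big1 // => q _; apply: matchings0.
Qed.

Lemma matchings_uniq (t : seq (L * T * L)) K : uniq [seq x.1.2 | x <- t] ->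
  matchings [seq x.1 | x <- t] [seq (x.1.2, x.2) | x <- t] K = K [seq (x.1.1, x.2) | x <- t].
Proof.
elim: t K => //= -[[i b] j] t IH K /= /andP[nb ut].
rewrite big_cons /= eqxx IH // big_map /= big_seq_cond big1 ?addr0 // => q /andP[/splitsP e].
move=> eb; case/negP: nb; rewrite -(eqP eb).
have : q.1.2 \in [seq (x.1.2, x.2) | x <- t] by rewrite e mem_cat mem_head orbT.
by case/mapP=> x xt -> /=; apply: (map_f (fun x => x.1.2)).
Qed.

Lemma splits_map (A B : eqType) (f : A -> B) s :
  splits (map f s) = [seq (map f q.1.1, f q.1.2, map f q.2) | q <- splits s].
Proof. by elim: s => //= x s ->; rewrite -!map_comp. Qed.

(** The label [b] is absent from [c], so the entries of [I] are matched within [J]; equal sizes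
    leave exactly [c] for [P]. *)
Lemma matchings_row (b : T) I J P c K : size I = size J -> b \notin map fst c ->
  matchings ([seq (i, b) | i <- I] ++ P) ([seq (b, j) | j <- J] ++ c) K =
  matchings [seq (i, b) | i <- I] [seq (b, j) | j <- J]
    (fun s => matchings P c (fun s' => K (s ++ s'))).
Proof.
move=> + nb; elim: I J K => [|i I IH] J K sz /=; first by case: J sz.
rewrite splits_cat big_cat !big_map /= [X in _ + X]big_seq_cond [X in _ + X]big1 ?addr0.
  rewrite splits_map !big_map /= big_seq_cond [RHS]big_seq_cond.
  apply: eq_bigr => q /andP[qJ _].
  rewrite catA -map_cat IH //; have := perm_size (perm_splits qJ); rewrite -sz => -[->].
  by rewrite size_cat.
move=> q /andP[/splitsP e eb]; case/negP: nb; rewrite -(eqP eb) e map_cat mem_cat /=.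
by rewrite mem_head orbT.
Qed.

End Pairings.

(** * Moving lowering letters past raising letters *)

Section Straightening.
Variables (V : zmodType) (m0 m1 n : nat).
Local Notation Sy := (ssym m0 m1 n).
Local Notation SX := (ssym m0 m1 n * ssym m0 m1 n)%type.
Local Notation LX := ('I_n * 'I_n)%type.
Local Notation emb := (@emb m0 m1 n).
Local Notation ps := (@psym m0 m1 n).
Local Notation gp := (gpar (@parS m0 m1 n)).

Definition beta (b : 'I_m1) : Sy := inr (inl b).
Definition lower (p : 'I_n * 'I_m1) : SX := (ps p.1, beta p.2).
Definition raise (c : 'I_m1 * 'I_n) : SX := (beta c.1, ps c.2).

(** [phi] stands for the class of a word modulo Irr, and [Psi u s] for that of [u] followed by the
    normally ordered product of [s]. Beta's and proper symbols are all odd, so the letters between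
    them are even and swap without signs. *)
Variables (phi : seq SX -> V) (Psi : seq SX -> seq LX -> V).
Hypothesis phi_swap : forall u (x y : SX) v, gp x = false -> gp y = false ->
  phi (u ++ x :: y :: v) = phi (u ++ y :: x :: v)
    + (if x.2 == y.1 then phi (u ++ (x.1, y.2) :: v) else 0)
    - (if x.1 == y.2 then phi (u ++ (y.1, x.2) :: v) else 0).
Hypothesis phi_irr : forall u (x : SX), virtual x.2 -> phi (u ++ [:: x]) = 0.
Hypothesis Psi_nil : forall u, Psi u [::] = phi u.
Hypothesis Psi_cons : forall u x s,
  Psi u (x :: s) = Psi (u ++ [:: emb x]) s - \sum_(s' <- contract x.1 x.2 s) Psi u s'.

(* [x] ranges over beta's as well as proper symbols: the terms produced by
   [x = j] in the induction step are instances of the claim with [x := b']. *)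
Lemma phi_lower (x : 'I_m1 + 'I_n) b c u :
  phi (u ++ (inr x, beta b) :: map raise c) =
  \sum_(q <- splits c | q.1.2.1 == b)
    phi (u ++ (inr x, ps q.1.2.2) :: map raise (q.1.1 ++ q.2)).
Proof.
elim: c x u => [|[b' j] c IH] x u; first by rewrite phi_irr // big_nil.
rewrite /= big_mkcond big_cons /= -big_mkcond big_map /= phi_swap //=.
have := IH x (u ++ [:: raise (b', j)]); rewrite -!catA /= => ->.
have -> : (beta b == beta b') = (b' == b) by rewrite eq_sym.
have -> : (inr x == ps j :> Sy) = (x == inr j) by [].
rewrite addrAC [X in X + _ = _](_ : _ = \sum_(q <- splits c | q.1.2.1 == b)
    phi (u ++ (inr x, ps q.1.2.2) :: raise (b', j) :: map raise (q.1.1 ++ q.2))).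
  by rewrite addrC.
have [->|nx] := eqVneq x (inr j).
  have := IH (inl b') u; rewrite -/(beta b') => ->; rewrite -sumrB.
  apply: eq_bigr => q _; rewrite phi_swap //= eqxx.
  by rewrite -catA addr0.
rewrite subr0; apply: eq_bigr => q _; rewrite phi_swap //=.
have -> : (inr x == ps j :> Sy) = false by apply: negbTE.
by rewrite -catA addr0 subr0.
Qed.

(** Commuting e_{ij} leftwards past a lowering letter e_{j,beta} leaves the correction -e_{i,beta},
    which is one term of the contraction. *)
Lemma phi_proper_left i j P u v :
  phi (u ++ map lower P ++ emb (i, j) :: v) =
  phi (u ++ emb (i, j) :: map lower P ++ v)
  - \sum_(P' <- contract i j P) phi (u ++ map lower P' ++ v).
Proof.
elim: P u => [|p P IH] u; first by rewrite big_nil subr0.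
rewrite sum_contract /=; have := IH (u ++ [:: lower p]); rewrite -!catA /= => ->.
rewrite phi_swap //= /emb /=.
have -> : (ps p.1 == ps j) = (p.1 == j) by [].
rewrite addr0 opprD addrA; congr (_ - _); last first.
  by apply: eq_bigr => P' _; rewrite -catA.
Qed.

(** [phi_lower] turns one lowering letter and a raising letter of the same label into a proper
    letter, and [phi_proper_left] brings it to the front. Its corrections are the contractions in
    the recursion of [Psi]. *)
Lemma phi_straighten u P c : size P = size c ->
  phi (u ++ map lower P ++ map raise c) = matchings P c (Psi u).
Proof.
have [k sP] : exists k, size P = k by exists (size P).
elim: k P c u sP => [|k IH] P c u.
  by case: P => // _; case: c => //= _; rewrite cats0 Psi_nil.
case: P => [//|p P] /= [sP] sc.
(* Lowering letters commute, so the first one can be placed next to the raising letters. *)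
transitivity (phi ((u ++ map lower P) ++ lower p :: map raise c)).
  rewrite -catA; elim: (P) (u) => //= p' P' IHP u'.
  rewrite phi_swap //= subr0 addr0.
  by have := IHP (u' ++ [:: lower p']); rewrite -!catA.
rewrite phi_lower big_seq_cond [RHS]big_seq_cond; apply: eq_bigr => q /andP[qc _].
have sq : size P = size (q.1.1 ++ q.2).
  by have := perm_size (perm_splits qc); rewrite -sc => -[<-].
have := phi_proper_left p.1 q.1.2.2 P u (map raise (q.1.1 ++ q.2)).
rewrite -catA => ->; have := IH P (q.1.1 ++ q.2) (u ++ [:: emb (p.1, q.1.2.2)]) sP sq.
rewrite -!catA /= => ->.
under eq_big_seq => P' /size_contract sP'.
  rewrite IH ?sP' //; over.
rewrite matchings_contract -matchingsB; apply: eq_matchings => s _.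
by rewrite Psi_cons.
Qed.

Lemma phi_perm (A : eqType) (f : A -> SX) t t' u v :
  (forall u x y v, phi (u ++ f x :: f y :: v) = phi (u ++ f y :: f x :: v)) ->
  perm_eq t t' -> phi (u ++ map f t ++ v) = phi (u ++ map f t' ++ v).
Proof.
move=> fC p; move: t t' p u.
apply: perm_swap_ind => [//|s2 s1 s3 h1 h2 u|x s s' h u|x y s u].
- by rewrite h1.
- by have := h (u ++ [:: f x]); rewrite -!catA.
- by rewrite /= fC.
Qed.

(* With pairwise distinct labels only one matching survives, so [Psi [::] s] is
   the value of a product of mutually commuting lowering, resp. raising, letters. *)
Lemma Psi_perm s s' : (size s <= m1)%N -> perm_eq s s' -> Psi [::] s = Psi [::] s'.
Proof.
have lift_perm_eq (A B : eqType) (r r' : seq A) : perm_eq r r' ->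
    forall z : seq (A * B), map fst z = r -> exists2 z', perm_eq z z' & map fst z' = r'.
  move=> p; move: r r' p; apply: perm_swap_ind => [s0 z zs|s2 s1 s3 h1 h2 z|x r r' h z|x y r z].
  - by exists z.
  - move/h1=> [z' p' /h2[z'' p'' e]]; exists z'' => //; exact: perm_trans p' p''.
  - case: z => [//|q z] /= [<-] /h[z' p e]; exists (q :: z'); rewrite /= ?perm_cons ?e //.
  - case: z => [//|q [//|q' z]] /= [<- <- <-]; exists [:: q', q & z] => //.
    by rewrite -[q :: _]/([:: q] ++ [:: q'] ++ z) perm_catCA.
(* Distinct labels for the entries of [s]: the first [size s] beta's, which exist by [sm]. *)
move=> sm p; pose b := take (size s) (enum 'I_m1).
have sb : size b = size s by rewrite size_takel // size_enum_ord.
have ub : uniq b by rewrite take_uniq ?enum_uniq.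
have [z' pz ez'] := lift_perm_eq _ _ _ _ p (zip s b) (unzip1_zip (eq_leq (esym sb))).
have word z : uniq (map snd z) -> Psi [::] (map fst z) =
    phi (map lower [seq (x.1.1, x.2) | x <- z] ++ map raise [seq (x.2, x.1.2) | x <- z]).
  move=> uz; have := phi_straighten [::] (_ : size [seq (x.1.1, x.2) | x <- z] = size [seq (x.2, x.1.2) | x <- z]).
  rewrite /= => ->; last by rewrite !size_map.
  pose t := [seq (x.1.1, x.2, x.1.2) | x <- z].
  have := @matchings_uniq _ _ _ t (Psi [::]); rewrite /t -!map_comp /= => -> //.
  by congr Psi; apply: eq_map => -[[]].
have uz : uniq (map snd (zip s b)) by rewrite -/(unzip2 _) unzip2_zip ?sb.
rewrite -(unzip1_zip (eq_leq (esym sb)) : map fst _ = s) -ez' !word //; last first.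
  by rewrite -(perm_uniq (perm_map snd pz)).
rewrite -!map_comp.
have := @phi_perm _ (lower \o (fun x : LX * 'I_m1 => (x.1.1, x.2))) _ _ [::]
  (map (raise \o (fun x : LX * 'I_m1 => (x.2, x.1.2))) (zip s b)) _ pz.
rewrite /= => ->; last by move=> u x y v /=; rewrite phi_swap //= addr0 subr0.
have := @phi_perm _ (raise \o (fun x : LX * 'I_m1 => (x.2, x.1.2))) _ _
  (map (lower \o (fun x : LX * 'I_m1 => (x.1.1, x.2))) z') [::] _ pz.
by rewrite /= !cats0 => -> // u x y v /=; rewrite phi_swap //= addr0 subr0.
Qed.

End Straightening.

(** * Expansion of permanents and bitableaux into matchings *)

Section Permanents.
Variables (n : nat).
Local Notation LX := ('I_n * 'I_n)%type.

Definition mon_of (s : seq LX) : mon n := [ffun k => count_mem k s].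

Definition enum_mon (m : mon n) : seq LX := flatten [seq nseq (m k) k | k <- enum {: LX}].

Lemma count_enum_mon m k : count_mem k (enum_mon m) = m k.
Proof.
rewrite /enum_mon count_flatten -map_comp sumnE big_map.
rewrite (eq_bigr (fun j => if j == k then m k else 0%N)) => [|j _] /=.
  by rewrite -big_mkcond big_enum_cond /= (big_pred1 k) // => j; rewrite inE.
by rewrite count_nseq /=; case: eqP => [->|_]; rewrite ?mul1n ?mul0n.
Qed.

Lemma enum_monK m : mon_of (enum_mon m) = m.
Proof. by apply/ffunP => k; rewrite ffunE count_enum_mon. Qed.

Lemma perm_enum_mon s : perm_eq s (enum_mon (mon_of s)).
Proof. by apply/allP => k _ /=; rewrite count_enum_mon ffunE. Qed.

Lemma sum_splits (V : nmodType) (A : eqType) (x0 : A) s m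
    (F : seq A * A * seq A -> V) : size s = m ->
  \sum_(q <- splits s) F q = \sum_(k < m) F (take k s, nth x0 s k, drop k.+1 s).
Proof.
move=> <-; elim: s F => [|x s IH] F; first by rewrite big_nil big_ord0.
by rewrite /= big_cons big_map IH big_ord_recl /= ?take0 ?drop0.
Qed.

(** Expansion along the first row: a permutation amounts to the image of [ord0] and a permutation of
    the remaining points. *)
Lemma sum_lift_perm (V : nmodType) m (F : 'S_m.+1 -> V) :
  \sum_s F s = \sum_(k < m.+1) \sum_(s : 'S_m) F (lift_perm ord0 k s).
Proof.
rewrite pair_bigA /= (reindex (fun p : 'I_m.+1 * 'S_m => lift_perm ord0 p.1 p.2)) //=.
apply: onW_bij; apply: inj_card_bij; last by rewrite card_prod !card_Sn card_ord factS.
move=> [k s] [k' s'] /= e.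
have ek : k = k' by have /permP/(_ ord0) := e; rewrite !lift_perm_id.
congr (_, _) => //; apply/permP => r; have /permP/(_ (lift ord0 r)) := e.
by rewrite !lift_perm_lift ek => /lift_inj.
Qed.

Lemma nth_bump (A : Type) (x0 : A) s k a : (k < size s)%N ->
  nth x0 s (bump k a) = nth x0 (take k s ++ drop k.+1 s) a.
Proof.
move=> ks; rewrite nth_cat size_takel ?(ltnW ks) // /bump.
have [ka|ak] := leqP k a; last by rewrite add0n nth_take.
by rewrite nth_drop; congr nth; lia.
Qed.

Lemma pmon_lift i I J (k : 'I_(size I).+1) (s : 'S_(size I)) :
  size J = (size I).+1 ->
  @pmon n (i :: I) J (lift_perm ord0 k s) =
  [ffun x => ((x == (i, nth i J k)) + pmon (take k J ++ drop k.+1 J) s x)%N].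
Proof.
move=> sJ; apply/ffunP => x; rewrite !ffunE -!sum1_card big_mkcond /= big_ord_recl /=.
congr (_ + _)%N.
  rewrite inE /= lift_perm_id (tnth_nth i) /=.
  rewrite (set_nth_default i) ?sJ //.
  by case: x => x1 x2; rewrite xpair_eqE /= (eq_sym x1) (eq_sym x2); case: ifP.
rewrite [RHS]big_mkcond /=; apply: eq_bigr => r _.
rewrite !inE lift_perm_lift !(tnth_nth i) /= nth_bump // sJ; exact: ltn_ord.
Qed.

(** With a single label every bijection is admissible, and expanding the permanent along its first
    row reproduces the recursion of [matchings]. *)
Lemma sum_per (R : nzRingType) (V : zmodType) (T : eqType) (b : T) I J (F : mon n -> V) :
  size I = size J ->
  \sum_(t <- per R I J) F t.2 =
  matchings [seq (i, b) | i <- I] [seq (b, j) | j <- J] (fun s => F (mon_of s)).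
Proof.
have -> : \sum_(t <- per R I J) F t.2 = \sum_(s : 'S_(size I)) F (pmon J s).
  by rewrite /per /image_mem big_map big_enum.
elim: I J F => [|i I IH] J F sz /=.
  rewrite (eq_bigr (fun=> F (mon_of [::]))) => [|s _]; last first.
    by congr F; apply/ffunP => x; rewrite !ffunE; apply: eq_card0 => -[].
  by rewrite sumr_const card_Sn.
rewrite sum_lift_perm splits_map big_map /= eqxx.
rewrite (@sum_splits _ _ i _ (size I).+1) //; apply: eq_bigr => k _ /=.
pose G (m : mon n) := F [ffun x => ((x == (i, nth i J k)) + m x)%N].
rewrite -map_cat (@eq_matchings _ _ _ _ _ _ (fun s => G (mon_of s))); last first.
  by move=> s _; congr F; apply/ffunP => x; rewrite !ffunE /= eq_sym.
rewrite -IH; first by apply: eq_bigr => s _; rewrite pmon_lift.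
by move: sz (ltn_ord k) => /= sz kI; rewrite size_cat size_take size_drop -sz; case: ifP; lia.
Qed.

Lemma mon_of_cat s s' : mon_of (s ++ s') = [ffun k => (mon_of s k + mon_of s' k)%N].
Proof. by apply/ffunP => k; rewrite !ffunE count_cat. Qed.

Section Tableaux.
Variable (R : nzRingType) (V : zmodType).
Implicit Types (F : mon n -> V) (S T : seq (seq 'I_n)).

Definition tab_terms S T : seq (R * mon n) :=
  foldr (@plmul R n) (punit R n) (map (fun x => per R x.1 x.2) (zip S T)).

Lemma tab_terms1 S T t : t \in tab_terms S T -> t.1 = 1.
Proof.
rewrite /tab_terms; elim: (zip S T) t => [|x r IH] t /=; first by rewrite inE => /eqP ->.
by case/allpairsP=> -[a a'] /= [/imageP[s _ ->] /IH -> ->] /=; rewrite mulr1.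
Qed.

Lemma sum_plmul F (p q : seq (R * mon n)) :
  \sum_(t <- plmul p q) F t.2 =
  \sum_(a <- p) \sum_(b <- q) F [ffun k => (a.2 k + b.2 k)%N].
Proof. by rewrite /plmul big_allpairs_dep. Qed.

Variable m : nat.

(** Entries labelled by their row number. As [inord] is faithful only up to [m], later statements
    bound the number of rows by [m.+1]. *)
Fixpoint rowsL k S : seq ('I_n * 'I_m.+1) :=
  if S is om :: S' then [seq (i, inord k) | i <- om] ++ rowsL k.+1 S' else [::].

Fixpoint rowsR k T : seq ('I_m.+1 * 'I_n) :=
  if T is vp :: T' then [seq (inord k, j) | j <- vp] ++ rowsR k.+1 T' else [::].

Lemma rowsR_label k T r : (k + size T <= m.+1)%N -> (r < k)%N ->
  inord r \notin map fst (rowsR k T).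
Proof.
elim: T k => //= vp T IH k sk rk; rewrite map_cat mem_cat negb_or IH ?addSnnS //; last lia.
rewrite andbT -map_comp; apply/mapP => -[j _] /(congr1 val) /=.
by rewrite !inordK; lia.
Qed.

(** Different rows carry different labels, so [matchings_row] splits the bijections row by row, as
    the product of permanents does. *)
Lemma sum_tab_terms k S T F : shape S = shape T -> (k + size S <= m.+1)%N ->
  \sum_(t <- tab_terms S T) F t.2 =
  matchings (rowsL k S) (rowsR k T) (fun s => F (mon_of s)).
Proof.
elim: S T k F => [|om S IH] [|vp T] k F //= => [_ _|[sz sST] sk].
  by rewrite /tab_terms /= /punit big_seq1 /=; congr F; apply/ffunP => x; rewrite !ffunE.
have sT : size T = size S by rewrite -(size_map size) -[map _ _]sST size_map.
rewrite matchings_row //; last by apply: rowsR_label; rewrite ?sT //; lia.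
rewrite /tab_terms /= sum_plmul -/(tab_terms S T).
rewrite (@sum_per R V _ (inord k : 'I_m.+1) _ _ (fun a => \sum_(b <- tab_terms S T) F [ffun x => (a x + b.2 x)%N])) //.
apply: eq_matchings => s _.
rewrite (IH T k.+1 (fun b => F [ffun x => (mon_of s x + b x)%N])) ?addSnnS //.
by apply: eq_matchings => s' _; rewrite mon_of_cat.
Qed.

Definition col_tab (f : LX -> 'I_n) (s : seq LX) : seq (seq 'I_n) := [seq [:: f x] | x <- s].

(** For column shape all permanents are 1 by 1, so the bitableau is a single monomial. *)
Lemma sum_col_tab s F :
  \sum_(t <- tab_terms (col_tab fst s) (col_tab snd s)) F t.2 = F (mon_of s).
Proof.
elim: s F => [|[i j] s IH] F.
  by rewrite /tab_terms /= /punit big_seq1 /=; congr F; apply/ffunP => x; rewrite !ffunE.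
rewrite /tab_terms /= sum_plmul -/(tab_terms (col_tab fst s) (col_tab snd s)).
rewrite (@sum_per R V _ tt _ _ (fun a => \sum_(b <- tab_terms (col_tab fst s) (col_tab snd s))
  F [ffun x => (a x + b.2 x)%N])) //= big_cons big_nil eqxx addr0 /=.
rewrite (IH (fun b => F [ffun x => (mon_of [:: (i, j)] x + b x)%N])).
by rewrite -mon_of_cat.
Qed.

Lemma young_col_tab s : young_pair (col_tab fst s) (col_tab snd s).
Proof.
rewrite /young_pair.
have sh f : Defs.shape (col_tab f s) = nseq (size s) 1%N.
  by rewrite /Defs.shape /col_tab; elim: (s) => //= x r ->.
rewrite !sh eqxx andbT /is_partition all_nseq orbT andbT.
by case: (size s) => //= k; elim: k.
Qed.

End Tableaux.
End Permanents.

(** * The words of e_{S,D'} and e_{D',T} as lists of labelled entries *)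

Section TableauWords.
Variables (m0 m n : nat).
Implicit Types S T : seq (seq 'I_n).

Lemma bsym_inord k : (k < m.+1)%N -> @bsym m0 m.+1 n k = Some (beta m0 n (inord k)).
Proof.
move=> km; rewrite /bsym (insubT (fun i => (i < m.+1)%N) km) /=.
by congr (Some (beta _ _ _)); apply/val_inj; rewrite /= inordK.
Qed.

Lemma wSD_rows S : (size S <= m.+1)%N ->
  @wSD m0 m.+1 n S = map (@lower m0 m.+1 n) (rowsL m 0 S).
Proof.
rewrite /wSD => h; have {h} : (0 + size S <= m.+1)%N by [].
elim: S 0%N => //= om S IH k sk.
by rewrite bsym_inord ?IH ?map_cat -?map_comp //; lia.
Qed.

Lemma wDT_rows T : (size T <= m.+1)%N ->
  @wDT m0 m.+1 n T = map (@raise m0 m.+1 n) (rowsR m 0 T).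
Proof.
rewrite /wDT => h; have {h} : (0 + size T <= m.+1)%N by [].
elim: T 0%N => //= om T IH k sk.
by rewrite bsym_inord ?IH ?map_cat -?map_comp //; lia.
Qed.

Lemma size_rowsL k S : size (rowsL m k S) = sumn (shape S).
Proof. by elim: S k => //= om S IH k; rewrite size_cat size_map IH. Qed.

Lemma size_rowsR k T : size (rowsR m k T) = sumn (shape T).
Proof. by elim: T k => //= om T IH k; rewrite size_cat size_map IH. Qed.

End TableauWords.

(** * Normally ordered products *)

Section NormalOrdering.
Variables (R : comNzRingType) (n : nat).
Local Notation LX := ('I_n * 'I_n)%type.

(** The contracted lists are not subterms, hence the fuel [k]; contraction preserves length, so
    [size s] is exactly enough. *)
Fixpoint normal_terms_rec k (s : seq LX) : seq (R * seq LX) :=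
  match k, s with
  | k'.+1, x :: s' =>
    [seq (t.1, x :: t.2) | t <- normal_terms_rec k' s']
    ++ flatten [seq scl (-1) (normal_terms_rec k' s'') | s'' <- contract x.1 x.2 s']
  | _, _ => [:: (1, [::])]
  end.

(* The normally ordered product of the e_{ij}, (i, j) in [s]: in the
   realization e_{ij} = \sum_k x_{ik} d/dx_{jk} it puts all multiplications
   to the left of all derivations. *)
Definition normal_terms s := normal_terms_rec (size s) s.

Lemma normal_terms_cons x s : normal_terms (x :: s) =
  [seq (t.1, x :: t.2) | t <- normal_terms s]
  ++ flatten [seq scl (-1) (normal_terms s') | s' <- contract x.1 x.2 s].
Proof.
rewrite /normal_terms /=; congr (_ ++ flatten _).
by apply/eq_in_map => s' /size_contract ->.
Qed.

End NormalOrdering.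

(** * The quotient by Irr, where straightening is a matter of equalities *)

Section IrrQuotient.
Variables (R : comNzRingType) (m0 m1 n : nat).
Local Notation SX := (ssym m0 m1 n * ssym m0 m1 n)%type.
Local Notation LX := ('I_n * 'I_n)%type.
Local Notation emb := (@emb m0 m1 n).

Lemma inJ_inIrr (f : seq SX -> R) : inJ (@parS m0 m1 n) f -> inIrr f.
Proof.
move=> h; exists [::]; split=> //; move: h; congr inJ; apply/funext => w.
by rewrite /ssum big_nil subr0.
Qed.

Lemma inIrr_irregular c u w : irregular w -> @inIrr R m0 m1 n (fun v => c * sword R (u ++ w) v).
Proof.
move=> iw; exists [:: (c, u, w)]; split; first by rewrite /= iw.
by have := inJ0 R (@parS m0 m1 n); congr inJ; apply/funext => v; rewrite /ssum big_seq1 subrr.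
Qed.

Lemma inIrrB (f g : seq SX -> R) : inIrr f -> inIrr g -> inIrr (f - g).
Proof.
case=> [l [al hl]] [l' [al' hl']].
exists (l ++ [seq (- t.1.1, t.1.2, t.2) | t <- l']); split.
  by rewrite all_cat al all_map.
have := inJB hl hl'; congr inJ; apply/funext => w.
rewrite /ssum big_cat big_map /= !fctE.
rewrite [X in _ = _ - (_ + X)](_ : _ = - \sum_(t <- l') t.1.1 * sword R (t.1.2 ++ t.2) w).
  by ring.
by rewrite -sumrN; apply: eq_bigr => t _; rewrite mulNr.
Qed.

Definition irr_pred : {pred (seq SX -> R)} := fun f => `[< inIrr f >].

Fact irr_zmod_closed : zmod_closed irr_pred.
Proof.
split=> [|f g /asboolP hf /asboolP hg]; apply/asboolP; last exact: inIrrB.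
by apply: inJ_inIrr; apply: inJ0.
Qed.

HB.instance Definition _ := GRing.isZmodClosed.Build (seq SX -> R) irr_pred irr_zmod_closed.

(** Only the additive quotient is formed; scalars are kept inside [cls_term]. *)
Definition irr_quot : zmodType := Quotient.quot irr_pred.

Definition cls (f : seq SX -> R) : irr_quot := \pi_(Quotient.quot irr_pred)%qT f.

Lemma clsP f g : cls f = cls g <-> inIrr (f - g).
Proof.
split=> [/eqP|h]; first by rewrite -Quotient.idealrBE => /asboolP.
by apply/eqP; rewrite -Quotient.idealrBE; apply/asboolP.
Qed.

Lemma clsD f g : cls (f + g) = cls f + cls g.
Proof. exact: raddfD. Qed.


Lemma cls0 : cls 0 = 0.
Proof. exact: raddf0. Qed.

Lemma clsN f : cls (- f) = - cls f.
Proof. exact: raddfN. Qed.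

Definition cls_term (c : R) (w : seq SX) : irr_quot := cls (fun v => c * sword R w v).

Definition cls_word (w : seq SX) : irr_quot := cls (sword R w).

Lemma cls_term1 w : cls_term 1 w = cls_word w.
Proof. by congr cls; apply/funext => v; rewrite mul1r. Qed.

Lemma cls_termN c w : cls_term (- c) w = - cls_term c w.
Proof. by rewrite -clsN; congr cls; apply/funext => v; rewrite mulNr. Qed.

Lemma cls_term_bool (b : bool) w : cls_term b%:R w = if b then cls_word w else 0.
Proof.
case: b; first exact: cls_term1.
by rewrite -cls0; congr cls; apply/funext => v; rewrite mul0r.
Qed.

Lemma cls_ev l : cls (ev l) = \sum_(t <- l) cls_term t.1 t.2.
Proof.
elim: l => [|t l IH]; first by rewrite ev_nil cls0 big_nil.
rewrite big_cons -IH -clsD; congr cls; apply/funext => w.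
by rewrite /ev big_cons.
Qed.

Lemma cls_word_swap u (x y : SX) v :
  gpar (@parS m0 m1 n) x = false -> gpar (@parS m0 m1 n) y = false ->
  cls_word (u ++ x :: y :: v) = cls_word (u ++ y :: x :: v)
    + (if x.2 == y.1 then cls_word (u ++ (x.1, y.2) :: v) else 0)
    - (if x.1 == y.2 then cls_word (u ++ (y.1, x.2) :: v) else 0).
Proof.
move=> ex ey; have : cls (ev (ctx u v (rel_terms R (@parS m0 m1 n) x y))) = 0.
  by rewrite -cls0; apply/clsP; rewrite subr0; apply/inJ_inIrr/inJ_rel.
rewrite cls_ev /ctx /rel_terms /sgn ex /= !big_cons big_nil /= mul1r !cls_termN.
rewrite !cls_term_bool !cls_term1 addr0.
by move=> e; apply/eqP; rewrite -subr_eq0 -[X in _ == X]e; apply/eqP; rewrite !opprD opprK !addrA.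
Qed.

(** The rightmost letter consumes a virtual symbol that nothing has created yet. *)
Lemma cls_word_irr u (x : SX) : virtual x.2 -> cls_word (u ++ [:: x]) = 0.
Proof.
move=> vx; rewrite -cls_term1 -cls0; apply/clsP; rewrite subr0.
apply: inIrr_irregular; apply/existsP; exists ord0; apply/existsP; exists x.2.
by rewrite vx /= eqxx.
Qed.

Definition cls_normal (u : seq SX) (s : seq LX) : irr_quot :=
  \sum_(t <- normal_terms R s) cls_term t.1 (u ++ map emb t.2).

Lemma cls_normal_nil u : cls_normal u [::] = cls_word u.
Proof. by rewrite /cls_normal big_seq1 /= cats0 cls_term1. Qed.

Lemma cls_normal_cons u x s : cls_normal u (x :: s) =
  cls_normal (u ++ [:: emb x]) s - \sum_(s' <- contract x.1 x.2 s) cls_normal u s'.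
Proof.
rewrite /cls_normal normal_terms_cons big_cat big_map big_flatten big_map /=.
congr (_ + _); first by apply: eq_bigr => t _; rewrite -catA.
rewrite -sumrN; apply: eq_bigr => s' _; rewrite big_map -sumrN.
by apply: eq_bigr => t _; rewrite mulN1r cls_termN.
Qed.

End IrrQuotient.

(** * The map B*, its values on bitableaux, and uniqueness *)

Section StarMap.
Variables (R : numClosedFieldType) (n : nat).
Local Notation LX := ('I_n * 'I_n)%type.

Definition star_mon (m : mon n) : ser R LX := ev (normal_terms R (enum_mon m)).

(** A support is picked by choice, and [star_mapE] shows that it does not matter; functions of
    infinite support go to 0. *)
Definition star_map (p : mon n -> R) : ser R LX :=
  match pselect (finsupp p) with
  | left h => fun w => \sum_(m <- undup (sval (cid h))) p m * star_mon m w
  | right _ => fun=> 0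
  end.

Lemma star_mapE (s : seq (mon n)) (p : mon n -> R) w : uniq s ->
  (forall m, p m != 0 -> m \in s) ->
  star_map p w = \sum_(m <- s) p m * star_mon m w.
Proof.
move=> us sup; rewrite /star_map; case: pselect => [h|[]]; last by exists s.
case: cid => s' sup' /=.
have supp r : \sum_(m <- r) p m * star_mon m w =
    \sum_(m <- [seq m <- r | p m != 0]) p m * star_mon m w.
  rewrite big_filter [RHS]big_mkcond; apply: eq_bigr => m _.
  by case: eqP => //= ->; rewrite mul0r.
rewrite supp [RHS]supp; apply: perm_big; apply: uniq_perm.
- by rewrite filter_uniq ?undup_uniq.
- by rewrite filter_uniq.
- by move=> m; rewrite !mem_filter mem_undup; case: eqP => //= /eqP h'; rewrite sup ?sup'.
Qed.

Lemma star_map_linear : linmap star_map.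
Proof.
move=> a p q [sp hp] [sq hq].
have := inJ0 R (@parL n); congr inJ; apply/funext => w.
pose s := undup (sp ++ sq); have us : uniq s by apply: undup_uniq.
have ps m : p m != 0 -> m \in s by move=> /hp; rewrite mem_undup mem_cat => ->.
have qs m : q m != 0 -> m \in s by move=> /hq; rewrite mem_undup mem_cat orbC => ->.
rewrite !(star_mapE w us) //; last first.
  move=> m; apply: contraNT => ms; have [/eqP -> /eqP ->] : p m == 0 /\ q m == 0.
    by split; [apply: contraNT ms => /ps|apply: contraNT ms => /qs].
  by rewrite mulr0 addr0.
rewrite mulr_sumr -big_split /= -sumrB big1 // => m _; ring.
Qed.

Lemma star_map_bitab S T : star_map (bitab R S T) =
  ev (flatten [seq normal_terms R (enum_mon t.2) | t <- tab_terms R S T]).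
Proof.
apply/funext => w; rewrite /ev big_flatten big_map /=.
have pcE m : bitab R S T m = \sum_(t <- tab_terms R S T) (t.2 == m)%:R.
  rewrite /bitab /pcoef -/(tab_terms R S T) big_mkcond.
  by apply: eq_big_seq => t /tab_terms1 ->; case: ifP.
rewrite (@star_mapE (undup (map snd (tab_terms R S T)))) ?undup_uniq //; last first.
  move=> m; rewrite pcE mem_undup; apply: contraNT => nm.
  rewrite big_seq big1 // => t tl; case: eqP => // e; case/negP: nm.
  by rewrite -e map_f.
rewrite (eq_bigr (fun m => \sum_(t <- tab_terms R S T) (t.2 == m)%:R * star_mon m w));
  last by move=> m _; rewrite pcE mulr_suml.
rewrite exchange_big /=; apply: eq_big_seq => t tl.
rewrite (bigD1_seq t.2) ?undup_uniq ?mem_undup ?map_f //= eqxx mul1r big1 ?addr0 //.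
by move=> m; rewrite eq_sym => /negPf ->; rewrite mul0r.
Qed.

(** Both sides run over the same row-preserving bijections. The bitableau lists each resulting
    monomial by [enum_mon], straightening lists the matched pairs as they come, and [Psi_perm]
    identifies the two. *)
Lemma capelli_star_map S T : young_pair S T -> capelli S T (star_map (bitab R S T)).
Proof.
(* The bound provides one beta per entry, as [Psi_perm] requires, and makes [m1] a successor. *)
case/andP=> _ /eqP sST; exists (sumn (shape S)).+1 => m0 [//|m] _ /ltnW sm szS.
have szT : size T = size S by rewrite -(size_map size T) -[map _ T]sST size_map.
suff /clsP : cls (@embedF R m0 m.+1 n (star_map (bitab R S T))) =
  cls_word R (@wSD m0 m.+1 n S ++ @wDT m0 m.+1 n T) by [].
rewrite star_map_bitab embedF_ev cls_ev big_map big_flatten big_map /=.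
pose F (a : mon n) := cls_normal R [::] (enum_mon a) : irr_quot R m0 m.+1 n.
rewrite -[LHS]/(\sum_(t <- tab_terms R S T) F t.2).
rewrite (@sum_tab_terms _ _ _ m 0) // wSD_rows // wDT_rows ?szT //.
have := @phi_straighten _ _ _ _ _ _ (@cls_word_swap R m0 m.+1 n)
  (@cls_word_irr R m0 m.+1 n) (@cls_normal_nil R m0 m.+1 n)
  (@cls_normal_cons R m0 m.+1 n) [::] (rowsL m 0 S) (rowsR m 0 T).
rewrite /= => ->; last by rewrite size_rowsL size_rowsR -[RHS]/(sumn (Defs.shape T)) -sST.
apply: eq_matchings => s sz; rewrite /F; apply/esym.
apply: (@Psi_perm _ _ _ _ _ _ (@cls_word_swap R m0 m.+1 n)
  (@cls_word_irr R m0 m.+1 n) (@cls_normal_nil R m0 m.+1 n)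
  (@cls_normal_cons R m0 m.+1 n)); last exact: perm_enum_mon.
by rewrite sz size_rowsL.
Qed.

(** At a common large [m] the two conditions put the embedded difference in Irr, and [inIrr_embedF]
    applies. *)
Lemma capelli_unique S T (u u' : ser R LX) :
  capelli S T u -> capelli S T u' -> inJ (@parL n) ((u : seq LX -> R) - u').
Proof.
case=> M h [M' h']; pose m := maxn (maxn M M') (size S).
have [Mm M'm Sm] : [/\ M <= m, M' <= m & size S <= m]%N.
  by rewrite /m !leq_max !leqnn !orbT.
have := inIrrB (h m m Mm Mm Sm) (h' m m M'm M'm Sm).
move=> hI; apply: (@inIrr_embedF R m m n); move: hI; congr inIrr; apply/funext => w.
by rewrite !fctE /embedF; case: ifP => _; ring.
Qed.

(** [linmap] gives linearity only modulo J and on finite supports, so finite sums are reached by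
    induction. *)
Lemma linmap_sum (B : (mon n -> R) -> ser R LX) (c : mon n -> R) (s : seq (mon n)) :
  linmap B ->
  inJ (@parL n) ((B (fun m => \sum_(x <- s) c x * (m == x)%:R) : seq LX -> R)
                 - (fun w => \sum_(x <- s) c x * B (fun m => (m == x)%:R) w)).
Proof.
move=> linB; have fin1 x : finsupp (fun m : mon n => (m == x)%:R : R).
  by exists [:: x] => m; rewrite inE; case: (m == x); rewrite ?eqxx.
have fins r : finsupp (fun m : mon n => \sum_(x <- r) c x * (m == x)%:R).
  exists r => m; apply: contraNT => nm; rewrite big_seq big1 // => x xr.
  by case: eqP => [e|_]; rewrite ?mulr0 //; case/negP: nm; rewrite e.
elim: s => [|x s IH].
  have fin0 : finsupp (fun _ : mon n => 0 : R) by exists [::] => m; rewrite eqxx.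
  have e0 : (fun m : mon n => \sum_(x <- [::]) c x * (m == x)%:R) = (fun=> 0).
    by apply/funext => m; rewrite big_nil.
  have e1 : (fun _ : mon n => 1 * 0 + 0 : R) = (fun=> 0).
    by apply/funext => m; rewrite mulr0 addr0.
  (* Linearity applied to 0 = 1 * 0 + 0 puts -B(0) in J. *)
  have := inJN (linB 1 _ _ fin0 fin0); rewrite e0 e1; congr inJ; apply/funext => w.
  by rewrite !fctE big_nil; ring.
have := inJD (linB (c x) _ _ (fin1 x) (fins s)) IH; congr inJ; apply/funext => w.
rewrite !fctE big_cons.
have -> : (fun m => \sum_(j <- x :: s) c j * (m == j)%:R) =
    (fun m : mon n => c x * (m == x)%:R + \sum_(j <- s) c j * (m == j)%:R).
  by apply/funext => m; rewrite big_cons.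
ring.
Qed.

End StarMap.

Theorem mainTheorem2 (R : numClosedFieldType) (n : nat) :
  exists B : (mon n -> R) -> ser R ('I_n * 'I_n)%type,
    [/\ linmap B,
        (forall S T : seq (seq 'I_n), young_pair S T -> capelli S T (B (bitab R S T)))
      & (forall B' : (mon n -> R) -> ser R ('I_n * 'I_n)%type,
           linmap B' ->
           (forall S T : seq (seq 'I_n), young_pair S T -> capelli S T (B' (bitab R S T))) ->
           forall p : mon n -> R, finsupp p ->
             inJ (@parL n) (fun w => B p w - B' p w))].
Proof.
exists (@star_map R n); split; [exact: star_map_linear|exact: capelli_star_map|].
move=> B' linB' capB' p [s sup].
have pE : p = fun m => \sum_(x <- undup s) p x * (m == x)%:R.
  apply/funext => m; have [ms|nms] := boolP (m \in undup s).
    rewrite (bigD1_seq m) ?undup_uniq //= eqxx mulr1 big1 ?addr0 // => x.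
    by rewrite eq_sym => /negPf ->; rewrite mulr0.
  rewrite big_seq big1 => [|x xs].
    by apply/eqP; apply: contraNT nms => /sup; rewrite mem_undup.
  by case: eqP nms => [->|_ _]; rewrite ?xs ?mulr0.
(* Every monomial is the bitableau of a pair of column tableaux. *)
have monE (x : mon n) : (fun m => (m == x)%:R) =
    bitab R (col_tab fst (enum_mon x)) (col_tab snd (enum_mon x)).
  apply/funext => m; rewrite /bitab /pcoef -/(tab_terms R _ _) big_mkcond /=.
  rewrite (eq_big_seq (fun t => (m == t.2)%:R)) => [|t /tab_terms1 ->]; last first.
    by rewrite eq_sym; case: ifP.
  by rewrite (@sum_col_tab n R _ (enum_mon x) (fun t => (m == t)%:R : R)) enum_monK.
have hB := linmap_sum p (undup s) (@star_map_linear R n).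
have hB' := linmap_sum p (undup s) linB'.
(* On a monomial both maps represent the same Capelli *-bitableau, hence agree modulo J. *)
have hd : inJ (@parL n) (fun w => \sum_(x <- undup s)
    p x * (star_map (fun m => (m == x)%:R) w - B' (fun m => (m == x)%:R) w)).
  apply: inJ_sum => x; apply: inJZ; rewrite monE.
  apply: capelli_unique (capB' _ _ (young_col_tab _)).
  exact: capelli_star_map (young_col_tab _).
rewrite -pE in hB hB'; have := inJD (inJB hB hB') hd; congr inJ; apply/funext => w.
rewrite !fctE (eq_bigr _ (fun x _ => mulrBr _ _ _)) sumrB; ring.
Qed.
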